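(* Let $r\in\mathbb{N}\cup\{\infty\}$ and let $\mathscr{F}$ be a sheaf on $\mathbb{R}^d$ of $C^r$-functions satisfying property $(\mathscr{F}1)$ such that the topology of $\mathscr{F}(Y)$ is the $C^r$-topology for every open $Y\subseteq\mathbb{R}^d$. Let $X\subseteq\mathbb{R}^d$ be open, let $w:X\to\mathbb{K}$ and $\psi:X\to X$ be $C^r$-functions, and assume that the weighted composition operator $C_{w,\psi}:\mathscr{F}(X)\to\mathscr{F}(X)$, $f\mapsto w\cdot(f\circ\psi)$, is well-defined. Assume that additionally the following conditions hold. (a) There is an open, relatively compact exhaustion $(X_n)_{n\in\mathbb{N}}$ of $X$ such that for each $n\in\mathbb{N}$, every $x\in X\setminus\overline{X}_n$ and every open $W\subseteq X\setminus\overline{X}_n$ containing $x$ there is an open $U\subseteq W$ with $x\in U$ for which the restriction $r_X^{X_n\cup U}:\mathscr{F}(X)\to\mathscr{F}(X_n\cup U)$ has dense range. (b) $\ker\delta_x\neq\mathscr{F}(X)$ for each $x\in X$. (c) For every $m\in\mathbb{N}_0$ the set $\{y\in X:\ w(\psi^m(y))\neq 0\}$ is dense in $X$. Then the following are equivalent. (i) $C_{w,\psi}$ is topologizable on $\mathscr{F}(X)$. (ii) $\psi$ has stable orbits.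
   Context: $\mathbb{K}\in\{\mathbb{R},\mathbb{C}\}$. A sheaf of functions $\mathscr{F}$ on $\Omega=\mathbb{R}^d$ assigns to every open $X\subseteq\Omega$ a vector space $\mathscr{F}(X)$ of $\mathbb{K}$-valued functions on $X$ such that for open $Y\subseteq X$ the restriction $r_X^Y:\mathscr{F}(X)\to\mathscr{F}(Y)$, $f\mapsto f_{|Y}$, is well-defined, functions in $\mathscr{F}(X)$ agreeing on all members of an open cover of $X$ are equal, and for every open cover $(X_\iota)_{\iota\in I}$ of $X$ and $f_\iota\in\mathscr{F}(X_\iota)$ with $f_\iota=f_\kappa$ on $X_\iota\cap X_\kappa$ for all $\iota,\kappa\in I$ there is $f\in\mathscr{F}(X)$ with $f_{|X_\iota}=f_\iota$ for all $\iota$. It is a sheaf of $C^r$-functions if $\mathscr{F}(X)\subseteq C^r(X)$ for all open $X$. An open, relatively compact exhaustion of $X$ is a sequence $(X_n)$ of open subsets of $X$ with compact closures $\overline{X}_n\subseteq X_{n+1}$ and $\bigcup_n X_n=X$. $\mathscr{F}$ satisfies $(\mathscr{F}1)$ if for every open $X\subseteq\Omega$: $\mathscr{F}(X)$ is a webbed and ultrabornological Hausdorff locally convex space; $\mathscr{F}(X)\subseteq C(X)$; for each $x\in X$ the point evaluation $\delta_x:f\mapsto f(x)$ is a continuous linear functional on $\mathscr{F}(X)$; and for every open, relatively compact exhaustion $(X_n)$ of $X$ the canonical map $f\mapsto(f_{|X_n})_n$ is a topological isomorphism of $\mathscr{F}(X)$ onto the projective limit $\{(f_n)_n\in\prod_n\mathscr{F}(X_n):\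 f_n=f_{n+1|X_n}\ \forall n\}$ (with the topology induced by the product). The $C^r$-topology on (subspaces of) $C^r(X)$ is defined by the seminorms $\|f\|_{l,K}=\sup_{|\alpha|\le l}\sup_{x\in K}|\partial^\alpha f(x)|$, $l\in\mathbb{N}_0$, $l<r+1$, $K\subseteq X$ compact. $\psi^m$ is the $m$-fold iterate of $\psi$ ($\psi^0=\mathrm{id}$). A continuous map $\psi:X\to X$ has stable orbits if for every compact $K\subseteq X$ there is a compact $L\subseteq X$ with $\psi^m(K)\subseteq L$ for all $m\in\mathbb{N}$. A continuous linear operator $T$ on a locally convex space $E$ is topologizable if for every continuous seminorm $p$ on $E$ there is a continuous seminorm $q$ on $E$ such that for every $m\in\mathbb{N}$ there is $\gamma_m>0$ with $p(T^m x)\le\gamma_m q(x)$ for all $x\in E$. *)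

(* Defs.v *)
From HB Require Import structures.
From mathcomp Require Import all_boot all_order all_algebra.
From mathcomp Require Import complex.
From mathcomp Require Import all_classical all_reals all_analysis.

Set Implicit Arguments.
Unset Strict Implicit.
Unset Printing Implicit Defensive.
Import Order.TTheory GRing.Theory Num.Theory.
Import numFieldNormedType.Exports.
Local Open Scope classical_set_scope.
Local Open Scope ring_scope.

Variant scalar_kind := RealScalars | ComplexScalars.

Definition scalar_field (R : realType) (k : scalar_kind) : numFieldType :=
  match k with
  | RealScalars => R
  | ComplexScalars => R[i]
  end.

Definition scalar_of_real (R : realType) (k : scalar_kind) : R -> scalar_field R k :=
  match k return R -> scalar_field R k with
  | RealScalars => fun x => x
  | ComplexScalars => fun x => real_complex R x
  end.

(* The canonical norm of [scalar_field R k] takes its values in [scalar_field R k] itself;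
   suprema need the absolute value as an element of R. *)
Definition modulus (R : realType) (k : scalar_kind) : scalar_field R k -> R :=
  match k return scalar_field R k -> R with
  | RealScalars => fun x => `|x|
  | ComplexScalars => @ComplexField.Normc.normc R
  end.

Section locally_convex_spaces.
Variable K : numFieldType.

Definition absolutely_convex (E : lmodType K) (A : set E) :=
  forall (x y : E) (a b : K),
    A x -> A y -> `|a| + `|b| <= 1 -> A (a *: x + b *: y).

(* De Wilde's webs; the finite sequence of indices (a_0, ..., a_k) of the
   member of the web is [mkseq a k.+1]. *)
Definition is_web (E : tvsType K) (C : seq nat -> set E) :=
  [/\ C [::] = setT,
      forall s, C s = \bigcup_n C (rcons s n),
      forall s, absolutely_convex (C s) &
      forall a : nat -> nat, exists2 lam : nat -> K, (forall k, 0 < lam k) &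
        forall x : nat -> E, (forall k, C (mkseq a k.+1) (x k)) ->
          exists l : E, series (fun k => lam k *: x k) @ \oo --> l].

Definition webbed (E : tvsType K) := exists C, @is_web E C.

(* E carries the inductive locally convex topology of a family of Banach
   spaces B_i with respect to linear maps j_i, i.e. the finest locally convex
   topology for which every j_i is continuous. *)
Definition ultrabornological (E : tvsType K) :=
  exists (I : Type) (B : I -> completeNormedModType K)
         (j : forall i, {linear B i -> E}),
    (forall x : E, exists s : seq {i : I & B i},
       x = \sum_(z <- s) j (projT1 z) (projT2 z)) /\
    (forall U : set E, absolutely_convex U ->
       (nbhs (0 : E) U <-> forall i, nbhs (0 : B i) (j i @^-1` U))).

End locally_convex_spaces.

Section seminorms.
Variables (R : realType) (k : scalar_kind) (E : tvsType (scalar_field R k)).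

Definition seminorm (p : E -> R) :=
  [/\ forall x, 0 <= p x,
      forall x y, p (x + y) <= p x + p y &
      forall (a : scalar_field R k) x, p (a *: x) = modulus a * p x].

Definition continuous_seminorm (p : E -> R) := seminorm p /\ continuous p.

Definition topology_defined_by (P : set (E -> R)) :=
  forall (x : E) (A : set E), nbhs x A <->
    exists (n : nat) (p : 'I_n -> E -> R) (e : R),
      [/\ forall i, P (p i), 0 < e &
          [set y | forall i, p i (y - x) < e] `<=` A].

Definition topologizable (T : E -> E) :=
  [/\ linear T, continuous T &
      forall p, continuous_seminorm p ->
      exists2 q, continuous_seminorm q &
      forall m : nat, (0 < m)%N -> exists2 gamma : R, 0 < gamma &
      forall x, p (iter m T x) <= gamma * q x].

End seminorms.

(* An order of differentiability in {0, 1, 2, ...} U {oo}; None stands for oo,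
   and [order_le l r] for l < r + 1. *)
Definition order_le (l : nat) (r : option nat) : bool :=
  if r is Some n then (l <= n)%N else true.

(* A function on an open set X is represented by a total function on R^d whose
   values outside X are irrelevant. *)
Section differentiable_functions.
Variables (R : realType) (k : scalar_kind) (d : nat).
Implicit Types (f : 'rV[R]_d -> scalar_field R k) (X Y : set 'rV[R]_d).

Definition difference_quotient (i : 'I_d) f (x : 'rV[R]_d) (h : R) :
    scalar_field R k :=
  (scalar_of_real k h)^-1 * (f (h *: delta_mx 0 i + x) - f x).

Definition partial_derivable (i : 'I_d) f (x : 'rV[R]_d) :=
  cvg (difference_quotient i f x @ 0^').

Definition partial (i : 'I_d) f (x : 'rV[R]_d) : scalar_field R k :=
  lim (difference_quotient i f x @ 0^').

Fixpoint finite_class (n : nat) X f : Prop :=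
  (forall x, X x -> {for x, continuous f}) /\
  match n with
  | 0 => True
  | n'.+1 => forall i, (forall x, X x -> partial_derivable i f x) /\
                       finite_class n' X (partial i f)
  end.

Definition Cr (r : option nat) X f :=
  forall l, order_le l r -> finite_class l X f.

Definition multi_partial (alpha : {ffun 'I_d -> nat}) f :
    'rV[R]_d -> scalar_field R k :=
  foldr (fun i g => iter (alpha i) (partial i) g) f (enum 'I_d).

Definition Cr_norm (l : nat) (Q : set 'rV[R]_d) f : R :=
  sup [set t | exists (alpha : {ffun 'I_d -> nat}) (x : 'rV[R]_d),
    [/\ (\sum_i alpha i <= l)%N, Q x & t = modulus (multi_partial alpha f x)]].

End differentiable_functions.

(* [sections X] is the space F(X) and [fun_of f] the function on X that f is;
   the values at sets X that are not open are irrelevant. *)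
Record function_sheaf (R : realType) (k : scalar_kind) (d : nat) := {
  sections :> set 'rV[R]_d -> tvsType (scalar_field R k);
  fun_of : forall X, sections X -> 'rV[R]_d -> scalar_field R k;
  restr : forall X Y, sections X -> sections Y;
  fun_of_inj : forall X, open X -> forall f g : sections X,
    (forall x, X x -> fun_of f x = fun_of g x) -> f = g;
  fun_of_linear : forall X, open X -> forall a (f g : sections X) x, X x ->
    fun_of (a *: f + g) x = a * fun_of f x + fun_of g x;
  fun_of_restr : forall X Y, open X -> open Y -> Y `<=` X ->
    forall (f : sections X) x, Y x -> fun_of (restr Y f) x = fun_of f x;
  sheaf_locality : forall (I : Type) (X : set 'rV[R]_d)
      (U : I -> set 'rV[R]_d),
    open X -> (forall i, open (U i)) -> X = \bigcup_i U i ->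
    forall f g : sections X, (forall i, restr (U i) f = restr (U i) g) ->
    f = g;
  sheaf_gluing : forall (I : Type) (X : set 'rV[R]_d)
      (U : I -> set 'rV[R]_d) (f : forall i, sections (U i)),
    open X -> (forall i, open (U i)) -> X = \bigcup_i U i ->
    (forall i j x, U i x -> U j x -> fun_of (f i) x = fun_of (f j) x) ->
    exists g : sections X, forall i, restr (U i) g = f i
}.

Section sheaf_properties.
Variables (R : realType) (k : scalar_kind) (d : nat).
Variable F : function_sheaf R k d.
Implicit Types X Y : set 'rV[R]_d.

Definition sheaf_of_Cr_functions (r : option nat) :=
  forall X, open X -> forall f : F X, Cr r X (fun_of f).

Definition Cr_topology (r : option nat) Y :=
  topology_defined_by
    [set p : F Y -> R | exists (l : nat) (Q : set 'rV[R]_d),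
      [/\ order_le l r, compact Q, Q `<=` Y &
          p = fun f => Cr_norm l Q (fun_of f)]].

Definition exhaustion X (Xs : nat -> set 'rV[R]_d) :=
  [/\ forall n, open (Xs n) /\ Xs n `<=` X,
      forall n, compact (closure (Xs n)),
      forall n, closure (Xs n) `<=` Xs n.+1 &
      \bigcup_n Xs n = X].

Definition projective_limit (Xs : nat -> set 'rV[R]_d) :
    set (prod_topology (fun n => F (Xs n))) :=
  [set f | forall n, f n = restr (Xs n) (f n.+1)].

Definition canonical_map X (Xs : nat -> set 'rV[R]_d) (f : F X) :
    prod_topology (fun n => F (Xs n)) :=
  fun n => restr (Xs n) f.

(* The inverse of the canonical map is a function on the whole product of which
   only the restriction to the projective limit matters. *)
Definition projective_limit_iso X (Xs : nat -> set 'rV[R]_d) :=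
  [/\ forall f : F X, projective_limit (canonical_map Xs f),
      continuous (@canonical_map X Xs) &
      exists inv : prod_topology (fun n => F (Xs n)) -> F X,
        [/\ forall f, inv (canonical_map Xs f) = f,
            forall g, projective_limit g -> canonical_map Xs (inv g) = g &
            {within @projective_limit Xs, continuous inv}]].

Definition property_F1 := forall X, open X ->
  [/\ webbed (F X) /\ ultrabornological (F X),
      hausdorff_space (F X),
      forall (f : F X) x, X x -> {for x, continuous (fun_of f)},
      forall x, X x -> continuous (fun f : F X => fun_of f x) &
      forall Xs, exhaustion X Xs -> projective_limit_iso X Xs].

(* As [fun_of] is injective, at most one T has this property, and one exists
   if and only if w (f o psi) lies in F(X) for all f in F(X). *)
Definition is_weighted_composition X (w : 'rV[R]_d -> scalar_field R k)
    (psi : 'rV[R]_d -> 'rV[R]_d) (T : F X -> F X) :=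
  forall (f : F X) x, X x -> fun_of (T f) x = w x * fun_of f (psi x).

End sheaf_properties.

Definition Cr_map (R : realType) (d : nat) (r : option nat)
    (X : set 'rV[R]_d) (psi : 'rV[R]_d -> 'rV[R]_d) :=
  forall i, @Cr R RealScalars d r X (fun x => psi x 0 i).

Definition stable_orbits (R : realType) (d : nat) (X : set 'rV[R]_d)
    (psi : 'rV[R]_d -> 'rV[R]_d) :=
  forall Q, compact Q -> Q `<=` X ->
  exists L, [/\ compact L, L `<=` X &
    forall m : nat, (0 < m)%N -> iter m psi @` Q `<=` L].

(* Main.v *)
Require Import Defs.
From HB Require Import structures.
From mathcomp Require Import all_boot all_order all_algebra.
From mathcomp Require Import complex.
From mathcomp Require Import all_classical all_reals all_analysis.
From mathcomp Require Import ring lra.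
Import Order.TTheory GRing.Theory Num.Theory.
Import numFieldNormedType.Exports.
Local Open Scope classical_set_scope.
Local Open Scope ring_scope.

(* The topology is given by the seminorms ||.||_{l,K}, so both implications are
   estimates.

   If the orbits are stable, the product and chain rules, together with Schwarz's
   theorem to put partial derivatives in a fixed order, bound ||T f||_{l,K} by
   C ||f||_{l, psi(K)}; iterating, ||T^m f||_{l,K} <= C_m ||f||_{l,L} for every
   compact L containing all psi^m(K).

   Conversely, apply topologizability to ||.||_{0,K'} with K' = closure X_N a
   neighbourhood of K: it gives a seminorm q living on some X_n.  If psi^m x lay
   outside closure X_n for some x in K, condition (c) would give y in K' near x
   with w(psi^j y) <> 0 for j < m and z = psi^m y outside closure X_n.  By gluing
   and density there is f in F(X) with q(f) < 1 and f(z) as large as we please,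
   although T^m f (y) = prod_(j < m) w(psi^j y) * f(z) is bounded by gamma_m. *)

Set Implicit Arguments.
Unset Strict Implicit.
Unset Printing Implicit Defensive.

(** * Scalars *)

(** The order of quantifiers carries both implications: q is fixed before m, whereas gamma_m is
    free. The growth of C_m and the size of the weights therefore never matter, only the compact set
    on which a seminorm lives. In the converse, K is enlarged to a neighbourhood because weights may
    vanish along the orbit of x itself; only a nearby y is guaranteed a nonzero product.

    The forward estimate has to be built from iterated coordinate difference quotients, without a
    total derivative. The chain rule is obtained from continuity of the partial derivatives via the
    mean value theorem, which needs real values; hence the splitting into real and imaginary parts.
    It also produces derivatives in every order, while the seminorms fix one order, so derivatives
    are indexed by words of coordinates. *)

Section scalars.
Variables (R : realType) (k : scalar_kind).
Local Notation K := (scalar_field R k).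
Local Notation "r %:K" := (scalar_of_real k r) (at level 2, format "r %:K").

(** The mean value theorem fails for complex values, so the calculus is done on real and imaginary
    parts. Over the reals the second part is zero, and one argument serves both fields. *)
Definition part (b : bool) : K -> R :=
  match k return scalar_field R k -> R with
  | RealScalars => fun z => if b then z else 0
  | ComplexScalars => fun z => if b then complex.Re z else complex.Im z
  end.

Lemma scalar_of_real_is_monoid_morphism : monoid_morphism (scalar_of_real k : R -> K).
Proof. by rewrite /scalar_of_real; case: k; split=> // x y; rewrite rmorphM. Qed.

Lemma scalar_of_real_is_zmod_morphism : zmod_morphism (scalar_of_real k : R -> K).
Proof. by rewrite /scalar_of_real; case: k => x y //; rewrite rmorphB. Qed.

HB.instance Definition _ := GRing.isZmodMorphism.Build R K
  (scalar_of_real k) scalar_of_real_is_zmod_morphism.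
HB.instance Definition _ := GRing.isMonoidMorphism.Build R K
  (scalar_of_real k) scalar_of_real_is_monoid_morphism.

Lemma scalar_of_real0 : (0 : R)%:K = 0.
Proof. exact: rmorph0. Qed.

Lemma scalar_of_realD (r s : R) : (r + s)%:K = r%:K + s%:K.
Proof. exact: rmorphD. Qed.

Lemma scalar_of_realM (r s : R) : (r * s)%:K = r%:K * s%:K.
Proof. exact: rmorphM. Qed.

Lemma scalar_of_realV (r : R) : (r^-1)%:K = r%:K^-1.
Proof. exact: fmorphV. Qed.

Lemma part_is_zmod_morphism b : zmod_morphism (part b).
Proof.
rewrite /part; case: k => x y; case: b => //; first by rewrite subr0.
- by case: x y => [? ?] [? ?].
- by case: x y => [? ?] [? ?].
Qed.

HB.instance Definition _ b := GRing.isZmodMorphism.Build K R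
  (part b) (part_is_zmod_morphism b).

Lemma partZ b r z : part b (r%:K * z) = r * part b z.
Proof.
rewrite /part /scalar_of_real; case: k z => [z|[x y]]; case: b => //=.
- by rewrite mulr0.
- by rewrite mul0r subr0.
- by rewrite mul0r addr0.
Qed.

Lemma part_real b r : part b r%:K = if b then r else 0.
Proof. by rewrite /part /scalar_of_real; case: k; case: b. Qed.

Lemma part_inj z z' : (forall b, part b z = part b z') -> z = z'.
Proof.
rewrite /part; case: k z z' => [z z' /(_ true)//|[x y] [x' y'] h].
by have /= -> := h true; have /= -> := h false.
Qed.

Lemma part_le_modulus b z : `|part b z| <= modulus z.
Proof.
rewrite /part /modulus; case: k z => [z|[x y]]; case: b => //=.
- by rewrite normr0.
- by rewrite -sqrtr_sqr ler_wsqrtr// lerDl sqr_ge0.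
- by rewrite -sqrtr_sqr ler_wsqrtr// lerDr sqr_ge0.
Qed.

Lemma modulus_le_parts z : modulus z <= `|part true z| + `|part false z|.
Proof.
rewrite /part /modulus; case: k z => [z|[x y]] /=; first by rewrite normr0 addr0.
rewrite -[leRHS]ger0_norm ?addr_ge0// -sqrtr_sqr ler_wsqrtr//.
by rewrite sqrrD !real_normK ?num_real// addrAC lerDl mulrn_wge0.
Qed.

(** The bridge to the K-valued norm: through the order embedding of R into K, most properties of
    [modulus] below are inherited from it. *)
Lemma norm_scalar (z : K) : `|z| = (modulus z)%:K.
Proof.
rewrite /modulus /scalar_of_real; case: k z => [z|[x y]].
 done.
rewrite normc_def.  done. Qed.

Lemma lt_scalar_of_real x y : (x%:K < y%:K :> K) = (x < y).
Proof. by rewrite /scalar_of_real; case: k => //; exact: ltcR. Qed.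

Lemma le_scalar_of_real x y : (x%:K <= y%:K :> K) = (x <= y).
Proof. by rewrite /scalar_of_real; case: k => //; exact: lecR. Qed.

Lemma scalar_of_real_inj : injective (scalar_of_real k : R -> K).
Proof. by rewrite /scalar_of_real; case: k => //; exact: complexI. Qed.

Lemma modulus_ge0 (z : K) : 0 <= modulus z.
Proof. by rewrite -le_scalar_of_real -norm_scalar scalar_of_real0 normr_ge0. Qed.

Lemma modulusM (z z' : K) : modulus (z * z') = modulus z * modulus z'.
Proof. by apply: scalar_of_real_inj; rewrite scalar_of_realM -!norm_scalar normrM. Qed.

Lemma ler_modulusD (z z' : K) : modulus (z + z') <= modulus z + modulus z'.
Proof. by rewrite -le_scalar_of_real scalar_of_realD -!norm_scalar ler_normD. Qed.

Lemma modulusN (z : K) : modulus (- z) = modulus z.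
Proof. by apply: scalar_of_real_inj; rewrite -!norm_scalar normrN. Qed.

Lemma modulus0 : modulus (0 : K) = 0.
Proof. by apply: scalar_of_real_inj; rewrite -!norm_scalar normr0 scalar_of_real0. Qed.

Lemma modulus_eq0 (z : K) : (modulus z == 0) = (z == 0).
Proof.
by rewrite -(inj_eq scalar_of_real_inj) -norm_scalar scalar_of_real0 normr_eq0.
Qed.

Lemma modulus_gt0 (z : K) : (0 < modulus z) = (z != 0).
Proof. by rewrite lt_neqAle modulus_ge0 andbT eq_sym modulus_eq0. Qed.

Lemma modulus_real r : modulus (r%:K : K) = `|r|.
Proof.
rewrite /modulus /scalar_of_real; case: k => //=.
by rewrite expr0n addr0 sqrtr_sqr.
Qed.

Lemma ler_modulus_sum I (s : seq I) (g : I -> K) :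
  modulus (\sum_(i <- s) g i) <= \sum_(i <- s) modulus (g i).
Proof.
elim: s => [|i s ih]; first by rewrite !big_nil modulus0.
by rewrite !big_cons (le_trans (ler_modulusD _ _))// lerD2l.
Qed.

Lemma gt0_scalar (e : K) : 0 < e -> exists2 r : R, 0 < r & e = r%:K.
Proof.
move=> e0; exists (modulus e); first by rewrite modulus_gt0 gt_eqF.
by rewrite -norm_scalar gtr0_norm.
Qed.

Lemma cvg_modulusP T (G : set_system T) {FG : Filter G} (f : T -> K) (l : K) :
  f @ G --> l <-> forall e : R, 0 < e -> \forall t \near G, modulus (l - f t) < e.
Proof.
split=> [/cvgrPdist_lt h e e0|h].
  have := h e%:K; rewrite -scalar_of_real0 lt_scalar_of_real.
  move=> /(_ e0); apply: filterS => t.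
  by rewrite norm_scalar lt_scalar_of_real.
apply/cvgrPdist_lt => e' /gt0_scalar[e e0 ->].
apply: filterS (h _ e0) => t.
by rewrite norm_scalar lt_scalar_of_real.
Qed.

Lemma cvg_partsP T (G : set_system T) {FG : Filter G} (f : T -> K) (l : K) :
  f @ G --> l <-> forall b, part b \o f @ G --> part b l.
Proof.
split=> [/cvg_modulusP h b|h].
  apply/cvgrPdist_lt => e e0; apply: filterS (h _ e0) => t.
  by apply: le_lt_trans; rewrite -raddfB part_le_modulus.
apply/cvg_modulusP => e e0.
have e20 : 0 < e / 2 by rewrite divr_gt0.
have /cvgrPdist_lt/(_ _ e20) ht := h true.
have /cvgrPdist_lt/(_ _ e20) hf := h false.
apply: filterS2 ht hf => t /= h1 h2.
apply: le_lt_trans (modulus_le_parts _) _.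
by rewrite !raddfB [ltRHS]splitr ltrD.
Qed.

Lemma continuous_modulus : continuous (@modulus R k).
Proof.
move=> z; apply/(@cvgrPdist_lt _ _ _ (nbhs z) (nbhs_filter z)) => e e0.
have : \forall y \near z, `|z - y| < e%:K.
  apply: (@cvgr_dist_lt _ _ _ (nbhs z)) => //.
  by rewrite -scalar_of_real0 lt_scalar_of_real.
apply: filterS => y; rewrite norm_scalar lt_scalar_of_real.
apply: le_lt_trans; have aux (u v : K) : modulus u - modulus v <= modulus (u - v).
  by rewrite lerBlDr (le_trans _ (ler_modulusD _ _))// subrK.
by rewrite ler_norml aux andbT lerNl opprB -(modulusN (z - y)) opprB aux.
Qed.

End scalars.

(** * Partial derivatives *)

Section row_vectors.
Variables (R : realType) (d : nat).
Implicit Types u v : 'rV[R]_d.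

Lemma rV_norm_le v e : 0 <= e -> (forall i, `|v 0 i| <= e) -> `|v| <= e.
Proof.
move=> e0 h; rewrite [leLHS]/Num.Def.normr/= mx_normrE.
by apply: bigmax_le => // -[i j] _ /=; rewrite ord1.
Qed.

Lemma coord_le_norm v i : `|v 0 i| <= `|v|.
Proof.
rewrite [leRHS]/Num.Def.normr/= mx_normrE.
exact: (le_bigmax _ (fun ij => `|v ij.1 ij.2|) (0, i)).
Qed.

Lemma norm_delta_le (i : 'I_d) (t : R) :
  `|t *: (delta_mx 0 i : 'rV[R]_d)| <= `|t|.
Proof.
apply: rV_norm_le => // j; rewrite !mxE /= normrM.
by case: (_ == _); rewrite ?normr1 ?mulr1// normr0 mulr0.
Qed.

Lemma cvg_line (i : 'I_d) (x : 'rV[R]_d) :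
  h *: (delta_mx 0 i : 'rV[R]_d) + x @[h --> 0^'] --> x.
Proof.
apply/cvgrPdist_lt => e e0; near=> h.
rewrite opprD addrCA subrr addr0 normrN (le_lt_trans (norm_delta_le _ _))//.
by near: h; apply: dnbhs0_lt.
Unshelve. all: by end_near. Qed.

End row_vectors.

Section partials.
Variables (R : realType) (k : scalar_kind) (d : nat).
Local Notation K := (scalar_field R k).
Local Notation "r %:K" := (scalar_of_real k r) (at level 2, format "r %:K").
Local Notation delta i := (delta_mx 0 i : 'rV[R]_d).
Implicit Types (f g : 'rV[R]_d -> K) (x y : 'rV[R]_d) (i j : 'I_d).

(** Since [partial] is a [lim] with a meaning only when the limit exists, this relation carries
    existence and value together. *)
Definition is_partial i f x (D : K) := difference_quotient i f x @ 0^' --> D.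

Lemma is_partial_val i f x D : is_partial i f x D -> partial i f x = D.
Proof. by move=> h; exact: (cvg_lim (@norm_hausdorff _ K) h). Qed.

Lemma is_partial_derivable i f x D :
  is_partial i f x D -> partial_derivable i f x.
Proof. by move=> h; apply/cvg_ex; exists D. Qed.

Lemma partial_derivableP i f x :
  partial_derivable i f x -> is_partial i f x (partial i f x).
Proof. by []. Qed.

Lemma is_partial_near i f g x D :
  (\forall y \near x, f y = g y) -> is_partial i f x D -> is_partial i g x D.
Proof.
rewrite /is_partial => fg hf; apply: cvg_trans hf; apply: near_eq_cvg.
have : \forall h \near (0:R)^', f (h *: delta i + x) = g (h *: delta i + x).
  exact: (cvg_line i fg).
apply: filterS => h /= fgh.
by rewrite /difference_quotient (nbhs_singleton fg) fgh.
Qed.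

Lemma is_partial_add i f g x D E : is_partial i f x D -> is_partial i g x E ->
  is_partial i (fun y => f y + g y) x (D + E).
Proof.
move=> hf hg; rewrite /is_partial.
rewrite (_ : difference_quotient _ _ _ = fun h =>
  difference_quotient i f x h + difference_quotient i g x h); last first.
  by apply/funext => h; rewrite /difference_quotient; ring.
exact: cvgD.
Qed.

Lemma is_partial_sub i f g x D E : is_partial i f x D -> is_partial i g x E ->
  is_partial i (fun y => f y - g y) x (D - E).
Proof.
move=> hf hg; rewrite /is_partial.
rewrite (_ : difference_quotient _ _ _ = fun h =>
  difference_quotient i f x h - difference_quotient i g x h); last first.
  by apply/funext => h; rewrite /difference_quotient; ring.
exact: cvgB.
Qed.

Lemma is_partial_cst i (c : K) x : is_partial i (fun=> c) x 0.
Proof.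
rewrite /is_partial (_ : difference_quotient _ _ _ = fun=> 0); first exact: cvg_cst.
by apply/funext => h; rewrite /difference_quotient subrr mulr0.
Qed.

Lemma is_partial_mul i f g x D E : {for x, continuous g} ->
  is_partial i f x D -> is_partial i g x E ->
  is_partial i (fun y => f y * g y) x (D * g x + f x * E).
Proof.
move=> cg hf hg; rewrite /is_partial.
rewrite (_ : difference_quotient _ _ _ = fun h =>
  difference_quotient i f x h * g (h *: delta i + x)
  + f x * difference_quotient i g x h); last first.
  by apply/funext => h; rewrite /difference_quotient; ring.
apply: cvgD; apply: cvgM => //; last exact: cvg_cst.
exact: cvg_comp (@cvg_line _ _ i x) cg.
Qed.

Lemma is_partial_shift i f (c : 'rV[R]_d) x D :
  is_partial i f (c + x) D -> is_partial i (fun y => f (c + y)) x D.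
Proof.
rewrite /is_partial (_ : difference_quotient i (fun y => _) _ =
  difference_quotient i f (c + x))//.
by apply/funext => h; rewrite /difference_quotient addrCA.
Qed.

(** The increment is real, so its inverse passes through the real-linear map [part b]. *)
Lemma difference_quotient_part b i f x :
  @difference_quotient R RealScalars d i (part b \o f) x =
  part b \o difference_quotient i f x.
Proof.
apply/funext => h; rewrite /difference_quotient /=.
by rewrite -scalar_of_realV partZ raddfB.
Qed.

Lemma is_partial_parts i f x D : is_partial i f x D <->
  forall b, @difference_quotient R RealScalars d i (part b \o f) x @ 0^'
    --> part b D.
Proof.
rewrite /is_partial; split=> [/cvg_partsP h b|h].
  by rewrite difference_quotient_part.
by apply/cvg_partsP => b; rewrite -difference_quotient_part.
Qed.

End partials.

(** * Mean value theorem, chain rule and Schwarz's theorem *)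

Section real_partials.
Variables (R : realType) (d : nat).
Local Notation delta i := (delta_mx 0 i : 'rV[R]_d).
Local Notation rpartial i f x D := (@is_partial R RealScalars d i f x D).
Implicit Types (f : 'rV[R]_d -> R) (x y u v : 'rV[R]_d) (i j : 'I_d).

(** The one-variable mean value theorem on [0, t] or [t, 0]. Bounding s by its absolute value lets
    one statement cover both signs of t. *)
Lemma line_mvt f (Df : 'rV[R]_d -> R) i y (t : R) :
  (forall s : R, `|s| <= `|t| -> rpartial i f (s *: delta i + y) (Df (s *: delta i + y))) ->
  exists2 s : R, `|s| <= `|t| &
    f (t *: delta i + y) - f y = t * Df (s *: delta i + y).
Proof.
move=> h; pose g (s : R) := f (s *: delta i + y).
have dg (s : R) : `|s| <= `|t| -> is_derive s (1 : R) g (Df (s *: delta i + y)).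
  move=> st; have hs := h s st.
  have E : (fun h0 : R => h0^-1 *: ((g \o shift s) (h0 *: 1) - g s)) =
           @difference_quotient R RealScalars d i f (s *: delta i + y).
    apply/funext => h0; rewrite /difference_quotient /g /=.
    by rewrite [h0 *: 1]mulr1 scalerDl addrA.
  apply: DeriveDef; first by rewrite /derivable E; apply/cvg_ex; eexists; exact: hs.
  by rewrite /derive E; apply: cvg_lim hs.
have main (a b : R) : a <= b -> (forall s, a <= s <= b -> `|s| <= `|t|) ->
    exists2 s : R, `|s| <= `|t| & g b - g a = Df (s *: delta i + y) * (b - a).
  move=> ab hab.
  have [||c] := @MVT_segment R g (fun s => Df (s *: delta i + y)) a b ab.
  - move=> s; rewrite in_itv /= => /andP[/ltW s1 /ltW s2].
    by apply: dg; apply: hab; rewrite s1 s2.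
  - apply: derivable_within_continuous => s; rewrite in_itv /= => s12.
    by have [] := dg s (hab s s12).
  - by rewrite in_itv /= => c12 ->; exists c => //; exact: hab.
have g0 : g 0 = f y by rewrite /g scale0r add0r.
have [t0|t0] := leP 0 t.
  have [s /andP[s1 s2]|s st E] := main 0 t t0.
    by rewrite ger0_norm// ger0_norm.
  by exists s => //; rewrite -/(g t) -g0 E subr0 mulrC.
have [s /andP[s1 s2]|s st E] := main t 0 (ltW t0).
  by rewrite ler0_norm// ltr0_norm// lerN2.
by exists s => //; rewrite -/(g t) -g0 -opprB E sub0r mulrN opprK mulrC.
Qed.

(* Walk from [a] to [v + a] along the coordinate axes, one axis at a time. *)
Lemma telescope_mvt f (Df : 'I_d -> 'rV[R]_d -> R) a v :
  (forall i u, `|u| <= `|v| -> rpartial i f (u + a) (Df i (u + a))) ->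
  exists xi : 'I_d -> 'rV[R]_d, (forall i, `|xi i| <= `|v|) /\
    f (v + a) - f a = \sum_i v 0 i * Df i (xi i + a).
Proof.
(* The corners of the walk. In the maximum norm, truncating v does not increase its norm, so the
   whole walk stays where the partial derivatives exist. *)
move=> h; pose tr n := \row_(j < d) (if (j < n)%N then v 0 j else 0).
have trS i : tr i.+1 = v 0 i *: delta i + tr i.
  apply/rowP => j; rewrite !mxE eqxx /= ltnS leq_eqVlt -val_eqE /=.
  case: eqP => [/val_inj ->|_] /=; last by rewrite mulr0 add0r.
  by rewrite ltnn mulr1 addr0.
have /choice[xi hxi] i : exists u, `|u| <= `|v| /\
    f (tr i.+1 + a) - f (tr i + a) = v 0 i * Df i (u + a).
  rewrite trS -addrA.
  have [s|s sv E] := @line_mvt f (Df i) i (tr i + a) (v 0 i).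
    move=> sv; rewrite addrA; apply: h; apply: rV_norm_le => // j.
    rewrite !mxE eqxx /= -val_eqE; case: eqP => /= [/val_inj ->|_].
      by rewrite ltnn mulr1 addr0 (le_trans sv)// coord_le_norm.
    by rewrite mulr0 add0r; case: ifP => _; rewrite ?normr0// coord_le_norm.
  exists (s *: delta i + tr i); split; last by rewrite E addrA.
  apply: rV_norm_le => // j.
  rewrite !mxE eqxx /= -val_eqE; case: eqP => /= [/val_inj ->|_].
    by rewrite ltnn mulr1 addr0 (le_trans sv)// coord_le_norm.
  by rewrite mulr0 add0r; case: ifP => _; rewrite ?normr0// coord_le_norm.
exists xi; split=> [i|]; first by have [] := hxi i.
transitivity (\sum_(i < d) (f (tr i.+1 + a) - f (tr i + a))); last first.
  by apply: eq_bigr => i _; have [] := hxi i.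
rewrite -(big_mkord xpredT (fun n => f (tr n.+1 + a) - f (tr n + a))).
rewrite (telescope_sumr (fun n => f (tr n + a)))//; congr (f (_ + _) - f _).
  by apply/rowP => j; rewrite mxE ltn_ord.
by rewrite -[LHS]add0r; congr (_ + _); apply/rowP => j; rewrite !mxE.
Qed.

Lemma cvg_sum_ord (n : nat) T (G : set_system T) {FG : Filter G}
    (u_ : 'I_n -> T -> R) (l : 'I_n -> R) :
  (forall p, u_ p t @[t --> G] --> l p) ->
  \sum_p u_ p t @[t --> G] --> \sum_p l p.
Proof.
move=> h; have aux (s : seq 'I_n) :
    \sum_(p <- s) u_ p t @[t --> G] --> \sum_(p <- s) l p.
  elim: s => [|p s ih].
    by rewrite big_nil; under eq_cvg do rewrite big_nil; exact: cvg_cst.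
  by rewrite big_cons; under eq_cvg do rewrite big_cons; apply: cvgD.
exact: aux.
Qed.

(** The increment of f is telescoped along the axes. The intermediate points tend to [psi x] with h,
    and continuity of the [Df j] there replaces total differentiability. *)
Lemma real_chain_rule f (Df : 'I_d -> 'rV[R]_d -> R) (psi : 'rV[R]_d -> 'rV[R]_d)
    i x (D : 'I_d -> R) :
  {for x, continuous psi} ->
  (\forall y \near psi x, forall j, rpartial j f y (Df j y)) ->
  (forall j, {for psi x, continuous (Df j)}) ->
  (forall j, rpartial i (fun y => psi y 0 j) x (D j)) ->
  rpartial i (f \o psi) x (\sum_j D j * Df j (psi x)).
Proof.
move=> cpsi /nbhs_normP[e /= e0 he] cDf hD.
pose v h := psi (h *: delta i + x) - psi x.
have v0 : v h @[h --> (0 : R)^'] --> (0 : 'rV[R]_d).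
  rewrite -(subrr (psi x)); apply: cvgB; last exact: cvg_cst.
  exact: cvg_comp (@cvg_line _ _ i x) cpsi.
have vsmall : \forall h \near (0 : R)^', `|v h| < e.
  by move/cvgrPdist_lt : v0 => /(_ _ e0); apply: filterS => h; rewrite sub0r normrN.
(* The choice is made for all h at once, with a dummy value where [v h] is too large; only small h
   count in the limit. *)
have /choice[xi hxi] h : exists xi : 'I_d -> 'rV[R]_d, `|v h| < e ->
    (forall j, `|xi j| <= `|v h|) /\
    f (v h + psi x) - f (psi x) = \sum_j v h 0 j * Df j (xi j + psi x).
  have [ve|] := pselect (`|v h| < e); last by exists (fun=> 0).
  have [j u uv|xi hxi] := @telescope_mvt f Df (psi x) (v h); last by exists xi.
  by apply: he; rewrite /ball_ /= opprD addrCA subrr addr0 normrN (le_lt_trans uv).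
rewrite /is_partial.
have : \sum_j @difference_quotient R RealScalars d i (fun y => psi y 0 j) x h
    * Df j (xi h j + psi x) @[h --> (0 : R)^'] --> \sum_j D j * Df j (psi x).
  apply: cvg_sum_ord => j; apply: cvgM; first exact: hD.
  suff xi0 : xi h j + psi x @[h --> (0 : R)^'] --> psi x.
    exact: (cvg_comp _ _ xi0 (cDf j)).
  apply/cvgrPdist_lt => r r0; move/cvgrPdist_lt : v0 => /(_ _ r0).
  apply: filterS2 vsmall => h ve hv; rewrite distrC addrK.
  move: hv; rewrite sub0r normrN.
  by apply: le_lt_trans; have [] := hxi h ve.
apply: cvg_trans; apply: near_eq_cvg; apply: filterS vsmall => h ve.
have [_] := hxi h ve; rewrite {1}/v subrK => E.
rewrite /difference_quotient /= E mulr_sumr; apply: eq_bigr => j _.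
by rewrite mulrA; congr (_ * _ * _); rewrite /v !mxE.
Qed.

(** Two mean value theorems: along the j-th axis for the increment of f in direction i, then along
    the i-th axis for [Fj]. The mixed difference is symmetric in i and j, which is what Schwarz's
    theorem exploits. *)
Lemma second_difference f Fj Fij i j a r h :
  (forall y, `|y - a| < r -> rpartial j f y (Fj y)) ->
  (forall y, `|y - a| < r -> rpartial i Fj y (Fij y)) ->
  `|h| + `|h| < r ->
  exists2 y, `|y - a| <= `|h| + `|h| &
    f (h *: delta i + (h *: delta j + a)) - f (h *: delta j + a)
    - (f (h *: delta i + a) - f a) = h * (h * Fij y).
Proof.
move=> hj hij hr.
have small i' j' s t : `|s| <= `|h| -> `|t| <= `|h| ->
    `|s *: delta i' + (t *: delta j' + a) - a| <= `|h| + `|h|.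
  move=> sh th; rewrite addrA addrK (le_trans (ler_normD _ _))//.
  by apply: lerD; rewrite (le_trans (norm_delta_le _ _)).
have small1 t : `|t| <= `|h| -> `|t *: delta j + a - a| < r.
  move=> th; rewrite addrK (le_lt_trans (norm_delta_le _ _))//.
  by rewrite (le_lt_trans th)// (le_lt_trans _ hr)// lerDl.
have [s sh|t th ->] := @line_mvt (fun y => f (h *: delta i + y) - f y)
    (fun y => Fj (h *: delta i + y) - Fj y) j a h.
  apply: is_partial_sub; last by apply: hj; exact: small1.
  by apply: is_partial_shift; apply: hj; apply: le_lt_trans hr; exact: small.
have [s sh|s sh ->] := @line_mvt Fj Fij i (t *: delta j + a) h.
  by apply: hij; apply: le_lt_trans hr; exact: small.
by exists (s *: delta i + (t *: delta j + a)) => //; exact: small.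
Qed.

Lemma real_schwarz f Fi Fj Fij Fji i j a :
  (\forall y \near a, [/\ rpartial i f y (Fi y), rpartial j f y (Fj y),
     rpartial i Fj y (Fij y) & rpartial j Fi y (Fji y)]) ->
  {for a, continuous Fij} -> {for a, continuous Fji} -> Fij a = Fji a.
Proof.
move=> /nbhs_normP[r /= r0 hr] cij cji; apply/eqP; rewrite -subr_eq0 -normr_eq0.
rewrite eq_le normr_ge0 andbT; apply/ler_addgt0Pl => e e0; rewrite addr0.
have e20 : 0 < e / 2 by rewrite divr_gt0.
have : \forall y \near a, `|Fij a - Fij y| < e / 2.
  exact: (@cvgr_dist_lt _ _ _ (nbhs a) _ _ _ cij).
move=> /nbhs_normP[r1 /= r10 h1].
have : \forall y \near a, `|Fji a - Fji y| < e / 2.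
  exact: (@cvgr_dist_lt _ _ _ (nbhs a) _ _ _ cji).
move=> /nbhs_normP[r2 /= r20 h2].
(* The intermediate points lie within 2h of a, and 2h = m/2 is below all three radii. *)
pose m := Num.min r (Num.min r1 r2); pose h := m / 4.
have m0 : 0 < m by rewrite !lt_min r0 r10 r20.
have h0 : 0 < h by rewrite divr_gt0.
have hm : `|h| + `|h| < m by rewrite gtr0_norm// /h; lra.
have [mr [mr1 mr2]] : m <= r /\ m <= r1 /\ m <= r2.
  by rewrite /m !ge_min !lexx !orbT.
have ball1 y : `|y - a| < r -> ball_ [eta Num.Def.normr] a r y.
  by rewrite /ball_ /= distrC.
have [y|y|y ya E1] := @second_difference f Fj Fij i j a r h _ _ (lt_le_trans hm mr).
  by move=> /ball1/hr[].
  by move=> /ball1/hr[].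
have [z|z|z za E2] := @second_difference f Fi Fji j i a r h _ _ (lt_le_trans hm mr).
  by move=> /ball1/hr[].
  by move=> /ball1/hr[].
(* Both sides evaluate the same mixed difference; cancelling h twice leaves [Fij y = Fji z] with y
   and z close to a. *)
have /(mulfI (lt0r_neq0 h0))/(mulfI (lt0r_neq0 h0)) E : h * (h * Fij y) = h * (h * Fji z).
  rewrite -E1 -E2 (addrCA (h *: delta i)); ring.
rewrite (_ : Fij a - Fji a = (Fij a - Fij y) - (Fji a - Fji z)); last first.
  by rewrite E; ring.
rewrite [e]splitr (le_trans (ler_normB _ _))// ltW// ltrD//.
  by apply: h1; rewrite /= distrC (le_lt_trans ya)// (lt_le_trans hm).
by apply: h2; rewrite /= distrC (le_lt_trans za)// (lt_le_trans hm).
Qed.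

End real_partials.

Section chain_rule.
Variables (R : realType) (k : scalar_kind) (d : nat).
Local Notation K := (scalar_field R k).
Local Notation "r %:K" := (scalar_of_real k r) (at level 2, format "r %:K").
Implicit Types (f : 'rV[R]_d -> K) (x y : 'rV[R]_d) (i j : 'I_d).

Lemma chain_rule f (Df : 'I_d -> 'rV[R]_d -> K) (psi : 'rV[R]_d -> 'rV[R]_d)
    i x (D : 'I_d -> R) :
  {for x, continuous psi} ->
  (\forall y \near psi x, forall j, is_partial j f y (Df j y)) ->
  (forall j, {for psi x, continuous (Df j)}) ->
  (forall j, @is_partial R RealScalars d i (fun y => psi y 0 j) x (D j)) ->
  is_partial i (f \o psi) x (\sum_j (D j)%:K * Df j (psi x)).
Proof.
move=> cpsi hf cDf hD; apply/is_partial_parts => b.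
rewrite raddf_sum /=; under eq_bigr do rewrite partZ.
apply: (@real_chain_rule R d (part b \o f) (fun j => part b \o Df j)) => //.
  by apply: filterS hf => y hy j; exact: (is_partial_parts _ _ _ _).1 (hy j) b.
by move=> j; exact: (cvg_partsP _ _).1 (cDf j) b.
Qed.

Lemma schwarz f Fi Fj Fij Fji i j a :
  (\forall y \near a, [/\ is_partial i f y (Fi y), is_partial j f y (Fj y),
     is_partial i Fj y (Fij y) & is_partial j Fi y (Fji y)]) ->
  {for a, continuous Fij} -> {for a, continuous Fji} -> Fij a = Fji a.
Proof.
move=> h cij cji; apply: part_inj => b.
apply: (@real_schwarz R d (part b \o f) (part b \o Fi) (part b \o Fj)
  (part b \o Fij) (part b \o Fji) i j a).
- apply: filterS h => y [h1 h2 h3 h4].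
  by split; exact: ((is_partial_parts _ _ _ _).1 _ b).
- exact: (cvg_partsP _ _).1 cij b.
- exact: (cvg_partsP _ _).1 cji b.
Qed.

End chain_rule.

(** * Functions of class C^n *)

Section finite_class_theory.
Variables (R : realType) (k : scalar_kind) (d : nat).
Local Notation K := (scalar_field R k).
Local Notation "r %:K" := (scalar_of_real k r) (at level 2, format "r %:K").
Variable X : set 'rV[R]_d.
Hypothesis X_open : open X.
Implicit Types (f g : 'rV[R]_d -> K) (x y : 'rV[R]_d) (i j : 'I_d).

Lemma near_open x (P : 'rV[R]_d -> Prop) :
  X x -> (forall y, X y -> P y) -> \forall y \near x, P y.
Proof. by move=> Xx h; apply: (filterS h); exact: open_nbhs_nbhs. Qed.

(** True even if no limit exists: the two difference quotients have the same image filter, hence the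
    same [lim]. *)
Lemma partial_near i f g x :
  (\forall y \near x, f y = g y) -> partial i f x = partial i g x.
Proof.
move=> fg; rewrite /partial; congr lim.
have E : \forall h \near (0 : R)^',
    difference_quotient i f x h = difference_quotient i g x h.
  have : \forall h \near (0 : R)^',
      f (h *: delta_mx 0 i + x) = g (h *: delta_mx 0 i + x).
    exact: (cvg_line i fg).
  by apply: filterS => h /= fgh; rewrite /difference_quotient (nbhs_singleton fg) fgh.
apply/seteqP; split; apply: near_eq_cvg => //.
by apply: filterS E => h ->.
Qed.

Lemma finite_class_continuous n f x :
  finite_class n X f -> X x -> {for x, continuous f}.
Proof. by case: n => [|n] /= [h _]; exact: h. Qed.

Lemma finite_class_partial n i f :
  finite_class n.+1 X f -> finite_class n X (partial i f).
Proof. by move=> /= [_ /(_ i)[]]. Qed.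

Lemma finite_class_is_partial n i f x :
  finite_class n.+1 X f -> X x -> is_partial i f x (partial i f x).
Proof. by move=> /= [_ /(_ i)[h _]] Xx; apply: partial_derivableP; exact: h. Qed.

Lemma finite_classW n f : finite_class n.+1 X f -> finite_class n X f.
Proof.
elim: n f => [|n ih] f [cf h]; first by split.
by split=> // i; have [h1 h2] := h i; split=> //; exact: ih.
Qed.

Lemma finite_class_le m n f :
  (m <= n)%N -> finite_class n X f -> finite_class m X f.
Proof.
move=> /subnK <-; elim: (n - m)%N => [//|p ih].
by rewrite addSn => /finite_classW/ih.
Qed.

Lemma continuous_near f g x : (\forall y \near x, f y = g y) ->
  {for x, continuous f} -> {for x, continuous g}.
Proof.
move=> fg; rewrite /prop_for /continuous_at -(nbhs_singleton fg) => cf.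
apply: cvg_trans cf; apply: (@near_eq_cvg _ _ (nbhs x) (nbhs_filter x)).
by apply: filterS fg.
Qed.

Lemma finite_class_eq n f g : (forall x, X x -> f x = g x) ->
  finite_class n X f -> finite_class n X g.
Proof.
have cX f1 g1 : (forall x, X x -> f1 x = g1 x) ->
    (forall x, X x -> {for x, continuous f1}) ->
    forall x, X x -> {for x, continuous g1}.
  by move=> fg cf x Xx; apply: continuous_near (cf x Xx); apply: near_open.
elim: n f g => [|n ih] f g fg [cf h]; split=> //; try exact: cX cf.
move=> i; have [hd hp] := h i; split=> [x Xx|].
  apply: (@is_partial_derivable _ _ _ i g x (partial i f x)).
  apply: is_partial_near (partial_derivableP (hd x Xx)).
  exact: near_open.
apply: ih hp => x Xx; apply: partial_near; exact: near_open.
Qed.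

(** Lets an explicit formula [Df] stand for [partial i f]. The two agree only on X, which suffices
    because X is open. *)
Lemma finite_classS n f : (forall x, X x -> {for x, continuous f}) ->
  (forall i, exists2 Df, forall x, X x -> is_partial i f x (Df x)
    & finite_class n X Df) ->
  finite_class n.+1 X f.
Proof.
move=> cf h; split=> // i; have [Df hDf cDf] := h i; split=> [x Xx|].
  exact: is_partial_derivable (hDf x Xx).
by apply: finite_class_eq cDf => x Xx; rewrite (is_partial_val (hDf x Xx)).
Qed.

Lemma finite_class_cst n (c : K) : finite_class n X (fun=> c).
Proof.
elim: n c => [|n ih] c; first by split=> // x _; exact: cst_continuous.
apply: finite_classS => [x _|i]; first exact: cst_continuous.
by exists (fun=> 0) => // x _; exact: is_partial_cst.
Qed.

Lemma finite_class_add n f g : finite_class n X f -> finite_class n X g ->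
  finite_class n X (fun y => f y + g y).
Proof.
elim: n f g => [|n ih] f g hf hg.
  split=> // x Xx.
  exact: (cvgD (finite_class_continuous hf Xx) (finite_class_continuous hg Xx)).
apply: finite_classS => [x Xx|i].
  exact: (cvgD (finite_class_continuous hf Xx) (finite_class_continuous hg Xx)).
exists (fun y => partial i f y + partial i g y) => [x Xx|].
  by apply: is_partial_add; apply: finite_class_is_partial Xx; eassumption.
by apply: ih; exact: finite_class_partial.
Qed.

Lemma finite_class_mul n f g : finite_class n X f -> finite_class n X g ->
  finite_class n X (fun y => f y * g y).
Proof.
elim: n f g => [|n ih] f g hf hg.
  split=> // x Xx.
  exact: (cvgM (finite_class_continuous hf Xx) (finite_class_continuous hg Xx)).
apply: finite_classS => [x Xx|i].
  exact: (cvgM (finite_class_continuous hf Xx) (finite_class_continuous hg Xx)).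
exists (fun y => partial i f y * g y + f y * partial i g y) => [x Xx|].
  apply: is_partial_mul; first exact: finite_class_continuous hg Xx.
    exact: finite_class_is_partial hf Xx.
  exact: finite_class_is_partial hg Xx.
apply: finite_class_add; apply: ih.
- exact: finite_class_partial.
- exact: finite_classW.
- exact: finite_classW.
- exact: finite_class_partial.
Qed.

Lemma finite_class_sum n (I : Type) (s : seq I) (F : I -> 'rV[R]_d -> K) :
  (forall p, finite_class n X (F p)) ->
  finite_class n X (fun y => \sum_(p <- s) F p y).
Proof.
move=> hF; elim: s => [|p s ih].
  apply: finite_class_eq (finite_class_cst n 0) => x _; by rewrite big_nil.
apply: finite_class_eq (finite_class_add (hF p) ih) => x _; by rewrite big_cons.
Qed.

Lemma continuous_of_real (u : 'rV[R]_d -> R) x :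
  {for x, continuous u} -> {for x, continuous (fun y => (u y)%:K)}.
Proof.
move=> cu; apply/(@cvg_partsP _ _ _ (nbhs x) (nbhs_filter x)) => b; rewrite part_real.
rewrite (_ : part b \o _ = if b then u else fun=> 0); last first.
  by apply/funext => y /=; rewrite part_real; case: b.
by case: b => //; exact: cvg_cst.
Qed.

Lemma is_partial_of_real i (u : 'rV[R]_d -> R) x D :
  @is_partial R RealScalars d i u x D -> is_partial i (fun y => (u y)%:K) x D%:K.
Proof.
move=> hu; apply/is_partial_parts => b; rewrite part_real.
rewrite (_ : part b \o _ = if b then u else fun=> 0); last first.
  by apply/funext => y /=; rewrite part_real; case: b.
by case: b => //; exact: is_partial_cst.
Qed.

End finite_class_theory.

(** * Composition with a map of class C^n *)

Section composition.
Variables (R : realType) (k : scalar_kind) (d : nat).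
Local Notation K := (scalar_field R k).
Local Notation "r %:K" := (scalar_of_real k r) (at level 2, format "r %:K").
Variable X : set 'rV[R]_d.
Hypothesis X_open : open X.
Implicit Types (f g : 'rV[R]_d -> K) (x y : 'rV[R]_d) (i j : 'I_d).

Lemma finite_class_of_real n (u : 'rV[R]_d -> R) :
  @finite_class R RealScalars d n X u ->
  finite_class n X (fun y => (u y)%:K).
Proof.
elim: n u => [|n ih] u hu.
  by split=> // x Xx; apply: continuous_of_real; exact: finite_class_continuous hu Xx.
apply: finite_classS => // [x Xx|i].
  by apply: continuous_of_real; exact: finite_class_continuous hu Xx.
exists (fun y => (@partial R RealScalars d i u y)%:K) => [x Xx|].
  by apply: is_partial_of_real; exact: finite_class_is_partial hu Xx.
by apply: ih; exact: (finite_class_partial i hu).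
Qed.

Variable psi : 'rV[R]_d -> 'rV[R]_d.
Hypothesis psi_X : forall x, X x -> X (psi x).
Local Notation coord j := (fun y => psi y 0 j).
Local Notation Dpsi i j := (@partial R RealScalars d i (coord j)).

Lemma coord_continuous n x :
  (forall j, @finite_class R RealScalars d n X (coord j)) -> X x ->
  {for x, continuous psi}.
Proof.
move=> h Xx; apply/(@cvgrPdist_le _ _ _ (nbhs x) (nbhs_filter x)) => e e0.
have : \forall y \near x, forall j, `|psi x 0 j - psi y 0 j| <= e.
  apply: (@filter_forall _ 'I_d (fun j y => `|psi x 0 j - psi y 0 j| <= e) (nbhs x) (nbhs_filter x)) => j.
  have := finite_class_continuous (h j) Xx.
  by move/(@cvgrPdist_le _ _ _ (nbhs x) (nbhs_filter x)); apply.
apply: filterS => y hy; apply: rV_norm_le; first exact: ltW.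
by move=> j; rewrite !mxE.
Qed.

Lemma is_partial_comp n i f x :
  (forall j, @finite_class R RealScalars d n.+1 X (coord j)) ->
  finite_class n.+1 X f -> X x ->
  is_partial i (f \o psi) x (\sum_j (Dpsi i j x)%:K * partial j f (psi x)).
Proof.
move=> hpsi hf Xx.
apply: (@chain_rule R k d f (fun j => partial j f) psi i x (fun j => Dpsi i j x)).
- exact: coord_continuous hpsi Xx.
- apply: (near_open X_open (psi_X Xx)) => y Xy j.
  exact: finite_class_is_partial hf Xy.
- move=> j; apply: finite_class_continuous (psi_X Xx).
  exact: finite_class_partial hf.
- by move=> j; apply: finite_class_is_partial (hpsi j) Xx.
Qed.

Lemma finite_class_comp n f :
  (forall j, @finite_class R RealScalars d n X (coord j)) ->
  finite_class n X f -> finite_class n X (f \o psi).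
Proof.
have c n' f' : (forall j, @finite_class R RealScalars d n' X (coord j)) ->
    finite_class n' X f' -> forall x, X x -> {for x, continuous (f' \o psi)}.
  move=> hpsi hf x Xx; have cf := finite_class_continuous hf (psi_X Xx).
  exact: (continuous_comp (coord_continuous hpsi Xx) cf).
elim: n f => [|n ih] f hpsi hf; first by split=> //; exact: c hpsi hf.
apply: finite_classS => //; first exact: c hpsi hf.
move=> i.
exists (fun x => \sum_j (Dpsi i j x)%:K * partial j f (psi x)) => [x Xx|].
  exact: is_partial_comp hpsi hf Xx.
apply: finite_class_sum => // j; apply: finite_class_mul => //.
  apply: finite_class_of_real; exact: (finite_class_partial i (hpsi j)).
apply: ih => [j'|]; first exact: finite_classW (hpsi j').
exact: finite_class_partial hf.
Qed.

End composition.

(** * Iterated partial derivatives *)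

Section iterated_partials.
Variables (R : realType) (k : scalar_kind) (d : nat).
Local Notation K := (scalar_field R k).
Local Notation "r %:K" := (scalar_of_real k r) (at level 2, format "r %:K").
Variable X : set 'rV[R]_d.
Hypothesis X_open : open X.
Implicit Types (f g : 'rV[R]_d -> K) (x y : 'rV[R]_d) (i j : 'I_d).
Implicit Types (s t : seq 'I_d).

(** Derivatives along an arbitrary word, its head being the outermost one. Words are closed under
    the steps of the chain rule, unlike the fixed order of [multi_partial]. *)
Definition ipartial s f := foldr (fun i g => partial i g) f s.

Lemma ipartial_cat s t f : ipartial (s ++ t) f = ipartial s (ipartial t f).
Proof. exact: foldr_cat. Qed.

Lemma ipartial_rcons s i f : ipartial (rcons s i) f = ipartial s (partial i f).
Proof. by rewrite -cats1 ipartial_cat. Qed.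

Lemma ipartial_eq s f g : (forall x, X x -> f x = g x) ->
  forall x, X x -> ipartial s f x = ipartial s g x.
Proof.
move=> fg; elim: s => [//|i s ih] x Xx /=.
by apply: partial_near; exact: (near_open X_open).
Qed.

Lemma finite_class_ipartial n s f :
  finite_class (size s + n) X f -> finite_class n X (ipartial s f).
Proof.
elim: s n => [//|i s ih] n; rewrite addSnnS => /ih.
exact: finite_class_partial.
Qed.

Lemma ipartial_add s f g : finite_class (size s) X f ->
  finite_class (size s) X g -> forall x, X x ->
  ipartial s (fun y => f y + g y) x = ipartial s f x + ipartial s g x.
Proof.
elim: s => [//|i s ih] hf hg x Xx /=.
have E y : X y -> ipartial s (fun y => f y + g y) y = ipartial s f y + ipartial s g y.
  by apply: ih; exact: finite_classW.
rewrite (partial_near _ (near_open X_open Xx E)); apply: is_partial_val.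
have aux f1 : finite_class (size s).+1 X f1 ->
    is_partial i (ipartial s f1) x (partial i (ipartial s f1) x).
  rewrite -addn1 => /finite_class_ipartial h.
  exact: finite_class_is_partial h Xx.
by apply: is_partial_add; exact: aux.
Qed.

Lemma ipartial_cst0 s x : ipartial s (fun=> 0) x = 0.
Proof.
elim: s x => [//|i s ih] x /=; rewrite (_ : ipartial s _ = fun=> 0).
  by apply: is_partial_val; exact: is_partial_cst.
exact/funext.
Qed.

Lemma ipartial_sum s (I : Type) (r : seq I) (F : I -> 'rV[R]_d -> K) :
  (forall p, finite_class (size s) X (F p)) -> forall x, X x ->
  ipartial s (fun y => \sum_(p <- r) F p y) x = \sum_(p <- r) ipartial s (F p) x.
Proof.
move=> hF x Xx; elim: r => [|p r ih].
  rewrite big_nil (@ipartial_eq s _ (fun=> 0))// => [|y _]; last by rewrite big_nil.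
  exact: ipartial_cst0.
rewrite big_cons -ih (@ipartial_eq s _ (fun y => F p y + \sum_(q <- r) F q y))//.
  by rewrite ipartial_add//; exact: finite_class_sum.
by move=> y _; rewrite big_cons.
Qed.

Lemma partialC f i j x : finite_class 2 X f -> X x ->
  partial i (partial j f) x = partial j (partial i f) x.
Proof.
move=> hf Xx; apply: (@schwarz R k d f (partial i f) (partial j f)
  (partial i (partial j f)) (partial j (partial i f)) i j x).
- apply: (near_open X_open Xx) => y Xy; split.
  + exact: finite_class_is_partial hf Xy.
  + exact: finite_class_is_partial hf Xy.
  + exact: finite_class_is_partial (finite_class_partial j hf) Xy.
  + exact: finite_class_is_partial (finite_class_partial i hf) Xy.
- apply: finite_class_continuous Xx.
  exact: (finite_class_partial i (finite_class_partial j hf)).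
- apply: finite_class_continuous Xx.
  exact: (finite_class_partial j (finite_class_partial i hf)).
Qed.

(** The index i travels outwards past the letters of s, one application of Schwarz's theorem for
    each. *)
Lemma ipartial_move s t i f : finite_class (size (s ++ i :: t)) X f ->
  forall x, X x -> ipartial (s ++ i :: t) f x = ipartial (i :: s ++ t) f x.
Proof.
elim: s => [//|j s ih] /= hf x Xx.
have E y : X y -> ipartial (s ++ i :: t) f y = partial i (ipartial (s ++ t) f) y.
  by apply: ih; exact: finite_classW.
rewrite (partial_near _ (near_open X_open Xx E)); apply: partialC => //.
apply: finite_class_ipartial; move: hf; rewrite !size_cat /=.
by rewrite addnS addn2.
Qed.

Lemma ipartial_perm s t f : perm_eq s t -> finite_class (size s) X f ->
  forall x, X x -> ipartial s f x = ipartial t f x.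
Proof.
elim: s t => [|i s ih] t st hf x Xx.
  by move: st; rewrite perm_sym => /perm_nilP ->.
have it : i \in t by rewrite -(perm_mem st) mem_head.
case/splitPr: it st => t1 t2 st.
have st' : perm_eq s (t1 ++ t2).
  rewrite -(perm_cons i) (perm_trans st)//.
  by rewrite -(cat1s i t2) perm_catCA.
have E y : X y -> ipartial s f y = ipartial (t1 ++ t2) f y.
  by apply: ih => //; exact: finite_classW.
rewrite ipartial_move//=; last by rewrite -(perm_size st).
exact: partial_near _ (near_open X_open Xx E).
Qed.

(** The sorted word that [multi_partial alpha] spells. *)
Definition index_seq (alpha : {ffun 'I_d -> nat}) : seq 'I_d :=
  flatten [seq nseq (alpha i) i | i <- enum 'I_d].

Lemma size_index_seq alpha : size (index_seq alpha) = (\sum_i alpha i)%N.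
Proof.
rewrite size_flatten sumnE /shape -map_comp big_map big_enum /=.
by apply: eq_bigr => i _; rewrite size_nseq.
Qed.

Lemma count_index_seq alpha i : count_mem i (index_seq alpha) = alpha i.
Proof.
rewrite count_flatten sumnE -map_comp big_map big_enum /= (bigD1 i)//=.
rewrite count_nseq /= eqxx mul1n big1 ?addn0// => j ji.
by rewrite count_nseq /= (negbTE ji).
Qed.

Lemma multi_partialE alpha f : multi_partial alpha f = ipartial (index_seq alpha) f.
Proof.
rewrite /multi_partial /index_seq; elim: (enum _) => [//|i s ih] /=.
rewrite ipartial_cat -ih; elim: (alpha i) => [//|n ihn] /=.
by rewrite ihn.
Qed.

(** Counting letters gives a multi-index whose sorted word is a permutation of t. Thus [Cr_norm],
    defined with multi-indices, controls derivatives in every order. *)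
Lemma ipartial_multi t f : finite_class (size t) X f ->
  exists2 alpha : {ffun 'I_d -> nat}, (\sum_i alpha i)%N = size t &
    forall x, X x -> ipartial t f x = multi_partial alpha f x.
Proof.
move=> hf; pose alpha : {ffun 'I_d -> nat} := [ffun i => count_mem i t].
have p : perm_eq t (index_seq alpha).
  by apply/allP => i _ /=; rewrite count_index_seq ffunE.
exists alpha; first by rewrite -size_index_seq (perm_size p).
by move=> x Xx; rewrite multi_partialE; exact: ipartial_perm.
Qed.

Lemma modulus_bounded n f Q : compact Q -> Q `<=` X -> finite_class n X f ->
  exists2 C, 0 <= C & forall x, Q x -> modulus (f x) <= C.
Proof.
move=> cQ QX hf; have [Q0|/set0P[x0 Qx0]] := eqVneq Q set0.
  by exists 0 => // x; rewrite Q0.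
have [||c] := @compact_EVT_max _ R (fun x => modulus (f x)) Q _ cQ.
- by exists x0.
- apply: continuous_in_subspaceT => x /set_mem Qx.
  apply: continuous_comp; first exact: finite_class_continuous hf (QX _ Qx).
  exact: continuous_modulus.
- move=> _ h; exists (modulus (f c)); first exact: modulus_ge0.
  by move=> x Qx; apply: h; rewrite inE.
Qed.

(* Induction on the outer derivatives: by the chain and product rules one
   derivative of [c * (ipartial b f \o psi)] is a finite sum of functions of
   the same shape. *)
Lemma ipartial_comp_bound (psi : 'rV[R]_d -> 'rV[R]_d) N Q :
  (forall x, X x -> X (psi x)) ->
  (forall j, @finite_class R RealScalars d N X (fun x => psi x 0 j)) ->
  compact Q -> Q `<=` X ->
  forall s b c, (size s <= N)%N -> finite_class (size s) X c ->
  exists2 C, 0 <= C & forall f M x, finite_class (size b + size s) X f -> Q x ->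
    (forall t, (size t <= size b + size s)%N -> modulus (ipartial t f (psi x)) <= M) ->
    modulus (ipartial s (fun y => c y * ipartial b f (psi y)) x) <= C * M.
Proof.
(* In [rcons s i] the letter i is differentiated first, so the product rule meets the product
   itself. The word b and the coefficient c stay general because that rule changes both. *)
move=> psi_X hpsi cQ QX; elim/last_ind => [|s i ih] b c sN hc.
  have [C C0 hC] := modulus_bounded cQ QX hc; exists C => // f M x _ Qx hM /=.
  rewrite modulusM ler_pM ?modulus_ge0//; first exact: hC.
  by apply: hM; rewrite addn0.
rewrite size_rcons in sN hc.
(* The coefficient with which the chain rule makes [ipartial (j :: b) f \o psi] appear. *)
pose e j := fun x => c x * (@partial R RealScalars d i (fun x => psi x 0 j) x)%:K.
have he j : finite_class (size s) X (e j).
  apply: finite_class_mul => //; first exact: finite_classW.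
  apply: finite_class_of_real => //.
  exact: (finite_class_partial i (finite_class_le sN (hpsi j))).
have [C0 C00 hC0] := ih b (partial i c) (ltnW sN) (finite_class_partial i hc).
have /choice[C hC] j : exists C, 0 <= C /\
    forall f M x, finite_class (size (j :: b) + size s) X f -> Q x ->
    (forall t, (size t <= size (j :: b) + size s)%N -> modulus (ipartial t f (psi x)) <= M) ->
    modulus (ipartial s (fun y => e j y * ipartial (j :: b) f (psi y)) x) <= C * M.
  by have [C ? ?] := ih (j :: b) (e j) (ltnW sN) (he j); exists C.
exists (C0 + \sum_j C j).
  by rewrite addr_ge0// sumr_ge0// => j _; have [] := hC j.
move=> f M x; rewrite size_rcons addnS => hf Qx hM.
have Xx := QX x Qx.
have hbf : finite_class (size s).+1 X (ipartial b f).
  by apply: finite_class_ipartial; rewrite addnS.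
have hpsi1 j := finite_class_le sN (hpsi j).
have hcomp n g : (n <= N)%N -> finite_class n X g -> finite_class n X (g \o psi).
  move=> nN; apply: finite_class_comp => // j; exact: finite_class_le nN (hpsi j).
have E y : X y -> partial i (fun y => c y * ipartial b f (psi y)) y =
    partial i c y * ipartial b f (psi y) +
    \sum_j e j y * ipartial (j :: b) f (psi y).
  move=> Xy; apply: is_partial_val.
  have := is_partial_mul (finite_class_continuous (hcomp _ _ sN hbf) Xy)
    (finite_class_is_partial (i := i) hc Xy)
    (is_partial_comp (i := i) X_open psi_X hpsi1 hbf Xy).
  rewrite mulr_sumr; congr is_partial; congr (_ + _).
  by apply: eq_bigr => j _; rewrite /e mulrA.
have h1 : finite_class (size s) X (fun y => partial i c y * ipartial b f (psi y)).
  apply: finite_class_mul => //; first exact: finite_class_partial.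
  exact: (hcomp _ _ (ltnW sN) (finite_classW hbf)).
have h2 j : finite_class (size s) X (fun y => e j y * ipartial (j :: b) f (psi y)).
  apply: finite_class_mul => //.
  exact: (hcomp _ _ (ltnW sN) (finite_class_partial j hbf)).
rewrite ipartial_rcons (ipartial_eq s E)// ipartial_add//; last exact: finite_class_sum.
rewrite ipartial_sum// mulrDl (le_trans (ler_modulusD _ _))// lerD//.
  apply: hC0 => //; first exact: finite_classW.
  by move=> t tb; apply: hM; rewrite leqW.
rewrite mulr_suml (le_trans (ler_modulus_sum _ _))// ler_sum// => j _.
by have [_] := hC j; apply.
Qed.

End iterated_partials.

(** * The seminorms of the C^r-topology *)

Section seminorm_theory.
Variables (R : realType) (k : scalar_kind) (E : tvsType (scalar_field R k)).
Local Notation "r %:K" := (scalar_of_real k r) (at level 2, format "r %:K").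
Implicit Types (p q : E -> R) (x y : E).

Lemma seminorm0 p : seminorm p -> p 0 = 0.
Proof. by move=> [_ _ h]; rewrite -(scale0r (0 : E)) h modulus0 mul0r. Qed.

Lemma seminormN p x : seminorm p -> p (- x) = p x.
Proof.
move=> [_ _ h]; rewrite -scaleN1r h modulusN.
have -> : modulus (1 : scalar_field R k) = 1; last by rewrite mul1r.
by rewrite -(rmorph1 (scalar_of_real k)) modulus_real normr1.
Qed.

(** Homogeneity turns an inclusion of balls into an inequality. *)
Lemma seminorm_le p q e : seminorm p -> seminorm q -> 0 < e ->
  (forall x, q x < e -> p x < 1) -> forall x, p x <= e^-1 * q x.
Proof.
move=> [_ _ pZ] [q0 _ qZ] e0 h x; apply/ler_addgt0Pr => eta eta0.
(* The term eta keeps the scaling factor positive when [q x] is 0; it is arbitrary, so it disappears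
   at the end. *)
pose t := e^-1 * q x + eta.
have t0 : 0 < t by rewrite /t ltr_wpDl// mulr_ge0// invr_ge0 ltW.
have /h : q ((t^-1)%:K *: x) < e.
  rewrite qZ modulus_real gtr0_norm ?invr_gt0// mulrC ltr_pdivrMr// /t mulrDr.
  by rewrite mulrA mulfV ?gt_eqF// mul1r ltrDl mulr_gt0.
rewrite pZ modulus_real gtr0_norm ?invr_gt0// mulrC ltr_pdivrMr// mul1r.
exact: ltW.
Qed.

Variable P : set (E -> R).
Hypothesis top : topology_defined_by P.
Hypothesis P_seminorm : forall p, P p -> seminorm p.

Lemma nbhs_seminorm p x e : P p -> 0 < e -> nbhs x [set y | p (y - x) < e].
Proof.
move=> Pp e0; apply/top; exists 1%N, (fun=> p), e; split=> // y /= h; exact: (h ord0).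
Qed.

Lemma defining_continuous p : P p -> continuous p.
Proof.
move=> Pp x; have [_ pD _] := P_seminorm Pp.
apply/(@cvgrPdist_lt _ _ _ (nbhs x) (nbhs_filter x)) => e e0.
have aux u v : p u - p v <= p (u - v).
  by rewrite lerBlDr (le_trans _ (pD _ _))// subrK.
apply: filterS (nbhs_seminorm x Pp e0) => y /=; apply: le_lt_trans.
rewrite ler_norml lerNl opprB aux /=.
by rewrite -(seminormN (y - x) (P_seminorm Pp)) opprB aux.
Qed.

End seminorm_theory.

(** A finite alphabet has finitely many words of length at most l. The induction adds up the bounds
    over the first letter, monotonicity of P allowing each to be enlarged. *)
Lemma uniform_bound (R : realType) (I : finType) l (P : seq I -> R -> Prop) :
  (forall s C C', P s C -> C <= C' -> P s C') ->
  (forall s, (size s <= l)%N -> exists2 C, 0 <= C & P s C) ->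
  exists2 C, 0 <= C & forall s, (size s <= l)%N -> P s C.
Proof.
elim: l P => [|l ih] P mono h.
  have [C C0 hC] := h [::] isT.
  by exists C => // s; rewrite leqn0 size_eq0 => /eqP ->.
have [C0 C00 hC0] := h [::] isT.
have /choice[C hC] i : exists C, 0 <= C /\
    forall s, (size s <= l)%N -> P (i :: s) C.
  have [|s sl|C ? ?] := ih (fun s => P (i :: s)); last by exists C.
    by move=> s C C'; exact: mono.
  exact: h.
exists (C0 + \sum_i C i).
  by rewrite addr_ge0// sumr_ge0// => i _; have [] := hC i.
move=> [_|i s sl]; first by apply: mono hC0 _; rewrite lerDl sumr_ge0// => i _; have [] := hC i.
have [_ hi] := hC i; apply: mono (hi s sl) _.
rewrite (bigD1 i)//= addrCA lerDl addr_ge0// sumr_ge0// => j _.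
by have [] := hC j.
Qed.

Section Cr_norms.
Variables (R : realType) (k : scalar_kind) (d : nat).
Local Notation K := (scalar_field R k).
Variable X : set 'rV[R]_d.
Hypothesis X_open : open X.
Implicit Types (f g : 'rV[R]_d -> K) (x y : 'rV[R]_d) (Q : set 'rV[R]_d).

(** Nonnegativity of M covers empty Q, where the supremum takes the value 0. *)
Lemma Cr_norm_le l Q f M : 0 <= M ->
  (forall s x, (size s <= l)%N -> Q x -> modulus (ipartial s f x) <= M) ->
  Cr_norm l Q f <= M.
Proof.
move=> M0 h; rewrite /Cr_norm; set A := [set _ | _].
have [->|/set0P A0] := eqVneq A set0; first by rewrite sup0.
apply: ge_sup => // _ [alpha [x [al Qx ->]]].
by rewrite multi_partialE; apply: h; rewrite // size_index_seq.
Qed.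

(** A [sup] is an upper bound only of a bounded set. Boundedness comes from compactness for each
    word and is then made uniform over words of length at most l. *)
Lemma modulus_multi_partial_le l Q f (alpha : {ffun 'I_d -> nat}) x : compact Q -> Q `<=` X ->
  finite_class l X f -> (\sum_i alpha i <= l)%N -> Q x ->
  modulus (multi_partial alpha f x) <= Cr_norm l Q f.
Proof.
move=> cQ QX hf al Qx; apply: ub_le_sup; last by exists alpha, x.
have [||C _ hC] := @uniform_bound R 'I_d l
    (fun s C => forall x, Q x -> modulus (ipartial s f x) <= C).
- by move=> s C C' h CC' y Qy; exact: le_trans (h y Qy) CC'.
- move=> s sl; apply: (modulus_bounded (n := 0) cQ QX).
  by apply: finite_class_ipartial; rewrite addn0; exact: finite_class_le sl hf.
- exists C => _ [beta [y [bl Qy ->]]]; rewrite multi_partialE.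
  by apply: hC => //; rewrite size_index_seq.
Qed.

Lemma modulus_ipartial_le l Q f s x : compact Q -> Q `<=` X ->
  finite_class l X f -> (size s <= l)%N -> Q x ->
  modulus (ipartial s f x) <= Cr_norm l Q f.
Proof.
move=> cQ QX hf sl Qx.
have [alpha E ->] := ipartial_multi X_open (finite_class_le sl hf); last exact: QX.
by apply: modulus_multi_partial_le => //; rewrite E.
Qed.

Lemma Cr_norm_ge0 l Q f : compact Q -> Q `<=` X -> finite_class l X f ->
  0 <= Cr_norm l Q f.
Proof.
move=> cQ QX hf; have [Q0|/set0P[x Qx]] := eqVneq Q set0.
  rewrite /Cr_norm (_ : [set _ | _] = set0) ?sup0//.
  by apply/seteqP; split=> // t [alpha [x []]]; rewrite Q0.
exact: le_trans (modulus_ge0 _) (modulus_ipartial_le cQ QX hf (s := [::]) _ Qx).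
Qed.

Lemma Cr_norm_mono l l' Q Q' f : (l <= l')%N -> Q `<=` Q' ->
  compact Q' -> Q' `<=` X -> finite_class l' X f ->
  Cr_norm l Q f <= Cr_norm l' Q' f.
Proof.
move=> ll QQ cQ QX hf; apply: Cr_norm_le; first exact: Cr_norm_ge0.
move=> s x sl Qx; apply: modulus_ipartial_le => //; first exact: leq_trans ll.
exact: QQ.
Qed.

(** Sections are total functions with arbitrary values off X, so identities such as the linearity of
    [fun_of] hold on X only. Derivatives at points of Q see no more than the open set X. *)
Lemma Cr_norm_eq l Q f g : Q `<=` X -> (forall x, X x -> f x = g x) ->
  Cr_norm l Q f = Cr_norm l Q g.
Proof.
move=> QX fg; have E alpha x : Q x -> multi_partial alpha f x = multi_partial alpha g x.
  by move=> /QX Xx; rewrite !multi_partialE; exact: ipartial_eq fg _ Xx.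
congr sup; apply/seteqP; split=> _ [alpha [x [al Qx ->]]];
  by exists alpha, x; split; rewrite // E.
Qed.

Lemma Cr_normD l Q f g : compact Q -> Q `<=` X ->
  finite_class l X f -> finite_class l X g ->
  Cr_norm l Q (fun x => f x + g x) <= Cr_norm l Q f + Cr_norm l Q g.
Proof.
move=> cQ QX hf hg; apply: Cr_norm_le; first by rewrite addr_ge0// Cr_norm_ge0.
move=> s x sl Qx; rewrite (@ipartial_add _ _ _ X)//; last exact: QX.
- by rewrite (le_trans (ler_modulusD _ _))// lerD// modulus_ipartial_le.
- exact: finite_class_le hf.
- exact: finite_class_le hg.
Qed.

Lemma ipartial_scale s (a : K) f x : finite_class (size s) X f -> X x ->
  ipartial s (fun y => a * f y) x = a * ipartial s f x.
Proof.
elim: s x => [//|i s ih] x hf Xx /=.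
have E y : X y -> ipartial s (fun y => a * f y) y = a * ipartial s f y.
  by apply: ih; exact: finite_classW.
have h1 : finite_class 1 X (ipartial s f).
  by apply: finite_class_ipartial; rewrite addn1.
rewrite (partial_near _ (near_open X_open Xx E)); apply: is_partial_val.
rewrite -[a * _]add0r -[0](mul0r (ipartial s f x)).
apply: (is_partial_mul (f := fun=> a)).
- exact: finite_class_continuous h1 Xx.
- exact: is_partial_cst.
- exact: finite_class_is_partial h1 Xx.
Qed.

(** For nonzero a, the reverse inequality is the direct one applied to the inverse of a and to a
    f. *)
Lemma Cr_normZ l Q (a : K) f : compact Q -> Q `<=` X -> finite_class l X f ->
  Cr_norm l Q (fun x => a * f x) = modulus a * Cr_norm l Q f.
Proof.
have main a' g : compact Q -> Q `<=` X -> finite_class l X g ->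
    Cr_norm l Q (fun x => a' * g x) <= modulus a' * Cr_norm l Q g.
  move=> cQ QX hg; apply: Cr_norm_le.
    by rewrite mulr_ge0 ?modulus_ge0// Cr_norm_ge0.
  move=> s x sl Qx; rewrite ipartial_scale; last exact: QX.
    by rewrite modulusM ler_wpM2l ?modulus_ge0// modulus_ipartial_le.
  exact: finite_class_le hg.
move=> cQ QX hf; have haf : finite_class l X (fun x => a * f x).
  by apply: finite_class_mul => //; exact: finite_class_cst.
apply/eqP; rewrite eq_le main//=; have [->|a0] := eqVneq a 0.
  rewrite modulus0 mul0r; apply: Cr_norm_ge0 => //.
  by apply: finite_class_mul => //; exact: finite_class_cst.
have : Cr_norm l Q (fun x => a^-1 * (a * f x)) <=
    modulus a^-1 * Cr_norm l Q (fun x => a * f x) by exact: main.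
rewrite (@Cr_norm_eq l Q _ f)//; last by move=> x _; rewrite mulKf.
move=> /(ler_wpM2l (modulus_ge0 a)); rewrite mulrA -modulusM mulfV//.
by rewrite -(rmorph1 (scalar_of_real k)) modulus_real normr1 mul1r.
Qed.

End Cr_norms.

(** * Stable orbits imply topologizability *)

Section sheaf_sections.
Variables (R : realType) (k : scalar_kind) (d : nat) (r : option nat).
Variable F : function_sheaf R k d.
Local Notation K := (scalar_field R k).
Local Notation "r %:K" := (scalar_of_real k r) (at level 2, format "r %:K").
Implicit Types (x y : 'rV[R]_d) (Q X Y : set 'rV[R]_d).
Hypothesis F_Cr : sheaf_of_Cr_functions F r.
Hypothesis F_top : forall Y, open Y -> Cr_topology F r Y.

Lemma fun_ofD Y (f g : F Y) x : open Y -> Y x ->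
  fun_of (f + g) x = fun_of f x + fun_of g x.
Proof. by move=> oY Yx; rewrite -{1}(scale1r f) fun_of_linear// mul1r. Qed.

Lemma fun_of0 Y x : open Y -> Y x -> fun_of (0 : F Y) x = 0.
Proof.
move=> oY Yx; have := fun_ofD (0 : F Y) 0 oY Yx.
by rewrite addr0 => /(congr1 (fun z => z - fun_of (0 : F Y) x)); rewrite subrr addrK.
Qed.

Lemma fun_ofZ Y a (f : F Y) x : open Y -> Y x ->
  fun_of (a *: f) x = a * fun_of f x.
Proof. by move=> oY Yx; rewrite -[a *: f]addr0 fun_of_linear// fun_of0// addr0. Qed.

Lemma fun_ofB Y (f g : F Y) x : open Y -> Y x ->
  fun_of (f - g) x = fun_of f x - fun_of g x.
Proof. by move=> oY Yx; rewrite fun_ofD// -scaleN1r fun_ofZ// mulN1r. Qed.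

Lemma Cr_norm_seminorm Y l Q : open Y -> order_le l r -> compact Q -> Q `<=` Y ->
  seminorm (fun f : F Y => Cr_norm l Q (fun_of f)).
Proof.
move=> oY lr cQ QY; split=> [f|f g|a f].
- by apply: (Cr_norm_ge0 oY) => //; exact: F_Cr.
- rewrite (@Cr_norm_eq _ _ _ _ oY l Q _ (fun x => fun_of f x + fun_of g x))//.
    by apply: (Cr_normD oY) => //; exact: F_Cr.
  by move=> x Yx; rewrite fun_ofD.
- rewrite (@Cr_norm_eq _ _ _ _ oY l Q _ (fun x => a * fun_of f x))//.
    by apply: (Cr_normZ oY) => //; exact: F_Cr.
  by move=> x Yx; rewrite fun_ofZ.
Qed.

Lemma Cr_norm_continuous_seminorm Y l Q :
  open Y -> order_le l r -> compact Q -> Q `<=` Y ->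
  continuous_seminorm (fun f : F Y => Cr_norm l Q (fun_of f)).
Proof.
move=> oY lr cQ QY; split; first exact: Cr_norm_seminorm.
apply: (defining_continuous (F_top oY)); last by exists l, Q.
by move=> p [l' [Q' [lr' cQ' QY' ->]]]; exact: Cr_norm_seminorm.
Qed.

Lemma Cr_norm_nbhs Y l Q e (h : F Y) :
  open Y -> order_le l r -> compact Q -> Q `<=` Y -> 0 < e ->
  nbhs h [set f | Cr_norm l Q (fun_of (f - h)) < e].
Proof.
move=> oY lr cQ QY e0.
apply: (nbhs_seminorm (F_top oY) (p := fun f => Cr_norm l Q (fun_of f))) => //.
by exists l, Q.
Qed.

(** The defining seminorms are directed: the larger order and the union of the compact sets dominate
    two of them, so finitely many reduce to one. *)
Lemma Cr_nbhs0 Y (A : set (F Y)) : open Y -> nbhs 0 A ->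
  exists l Q e, [/\ order_le l r, compact Q, Q `<=` Y, 0 < e &
    forall f : F Y, Cr_norm l Q (fun_of f) < e -> A f].
Proof.
move=> oY /(F_top oY)[n [p [e [hp e0 hA]]]].
suff [l [Q [lr cQ QY h]]] : exists l Q, [/\ order_le l r, compact Q, Q `<=` Y &
    forall i (f : F Y), p i f <= Cr_norm l Q (fun_of f)].
  exists l, Q, e; split=> // f fe; apply: hA => i /=.
  by rewrite subr0; exact: le_lt_trans (h i f) fe.
elim: n p hp {hA} => [|n ih] p hp.
  exists 0%N, set0; split=> //; first by rewrite /order_le; case: (r).
  - exact: compact0.
  - by case.
have [l [Q [lr cQ QY h]]] := ih (fun i => p (lift ord0 i)) (fun i => hp _).
have [l' [Q' [lr' cQ' QY' p0]]] := hp ord0.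
have mr : order_le (maxn l l') r.
  by move: lr lr'; rewrite /order_le; case: (r) => // ? ? ?; rewrite geq_max; apply/andP.
have cQQ : compact (Q `|` Q') by exact: compactU.
have QQY : Q `|` Q' `<=` Y by move=> x [/QY|/QY'].
exists (maxn l l'), (Q `|` Q'); split=> // i f.
have [j ->|->] := unliftP ord0 i.
  apply: le_trans (h j f) _; apply: (Cr_norm_mono oY) => //; first exact: leq_maxl.
  exact: F_Cr.
rewrite p0; apply: (Cr_norm_mono oY) => //; first exact: leq_maxr.
exact: F_Cr.
Qed.

Lemma continuous_seminorm_small Y (p : F Y -> R) : open Y ->
  continuous_seminorm p ->
  exists l Q e, [/\ order_le l r, compact Q, Q `<=` Y, 0 < e &
    forall f : F Y, Cr_norm l Q (fun_of f) < e -> p f < 1].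
Proof.
move=> oY [sp cp]; apply: (Cr_nbhs0 (A := [set f | p f < 1])) => //.
have /(@cvgrPdist_lt _ _ _ (nbhs (0 : F Y)) (nbhs_filter _)) /(_ 1 ltr01) := cp 0.
apply: filterS => f /=; rewrite (seminorm0 sp) sub0r normrN.
exact: le_lt_trans (ler_norm _).
Qed.

End sheaf_sections.

(** * Estimates for the weighted composition operator and its iterates *)

Section weighted_composition.
Variables (R : realType) (k : scalar_kind) (d : nat) (r : option nat).
Variable F : function_sheaf R k d.
Local Notation K := (scalar_field R k).
Local Notation "r %:K" := (scalar_of_real k r) (at level 2, format "r %:K").
Implicit Types (x y : 'rV[R]_d) (Q Y : set 'rV[R]_d).
Hypothesis F_Cr : sheaf_of_Cr_functions F r.
Hypothesis F_top : forall Y, open Y -> Cr_topology F r Y.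
Variables (X : set 'rV[R]_d) (w : 'rV[R]_d -> K) (psi : 'rV[R]_d -> 'rV[R]_d).
Variable T : F X -> F X.
Hypothesis X_open : open X.
Hypothesis w_Cr : Cr r X w.
Hypothesis psi_Cr : Cr_map r X psi.
Hypothesis psi_X : forall x, X x -> X (psi x).
Hypothesis T_def : is_weighted_composition w psi T.

Lemma order_le0 : order_le 0 r.
Proof. by rewrite /order_le; case: (r). Qed.

Lemma Cr_map_continuous x : X x -> {for x, continuous psi}.
Proof.
move=> Xx; apply: (@coord_continuous R d X psi 0) => // j.
by apply: psi_Cr; exact: order_le0.
Qed.

Lemma iter_psi_closed m x : X x -> X (iter m psi x).
Proof. by move=> Xx; elim: m => [//|m ih] /=; exact: psi_X. Qed.

Lemma Cr_map_iter_continuous m x : X x -> {for x, continuous (iter m psi)}.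
Proof.
elim: m x => [|m ih] x Xx; first exact: cvg_id.
exact: (continuous_comp (ih x Xx) (Cr_map_continuous (iter_psi_closed m Xx))).
Qed.

Lemma weighted_composition_linear : linear T.
Proof.
move=> a f g; apply: (fun_of_inj X_open) => x Xx.
by rewrite fun_of_linear// !T_def// fun_of_linear ?mulrDr 1?mulrCA//; exact: psi_X.
Qed.

Lemma Cr_map_image Q : compact Q -> Q `<=` X ->
  compact (psi @` Q) /\ psi @` Q `<=` X.
Proof.
move=> cQ QX; split; last by move=> _ [x /QX Xx <-]; exact: psi_X.
apply: continuous_compact => //; apply: continuous_in_subspaceT => x /set_mem Qx.
exact: Cr_map_continuous (QX x Qx).
Qed.

(** This is [ipartial_comp_bound] with empty inner word and coefficient w, made uniform over the
    words of length at most l. *)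
Lemma Cr_norm_weighted_composition l Q : order_le l r -> compact Q -> Q `<=` X ->
  exists2 C, 0 <= C & forall f : F X,
    Cr_norm l Q (fun_of (T f)) <= C * Cr_norm l (psi @` Q) (fun_of f).
Proof.
move=> lr cQ QX; have [cpQ pQX] := Cr_map_image cQ QX.
pose P s C := forall (f : F X) x, Q x ->
  modulus (ipartial s (fun_of (T f)) x) <= C * Cr_norm l (psi @` Q) (fun_of f).
have fl (f : F X) : finite_class l X (fun_of f) by exact: F_Cr.
have n0 (f : F X) : 0 <= Cr_norm l (psi @` Q) (fun_of f).
  exact: (Cr_norm_ge0 X_open).
have [||C C0 hC] := @uniform_bound R 'I_d l P.
- move=> s C C' h CC' f x Qx; apply: le_trans (h f x Qx) _.
  by rewrite ler_wpM2r.
- move=> s sl.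
  have hpsi j : @finite_class R RealScalars d l X (fun x => psi x 0 j).
    exact: psi_Cr.
  have [C C0 hC] := ipartial_comp_bound X_open psi_X hpsi cQ QX [::] sl
    (finite_class_le sl (w_Cr lr)).
  exists C => // f x Qx.
  rewrite (@ipartial_eq _ _ _ _ X_open s _ (fun y => w y * fun_of f (psi y))).
  + apply: (hC _ _ x (finite_class_le sl (fl f)) Qx) => t ts.
    apply: (modulus_ipartial_le X_open cpQ pQX (fl f)); first exact: leq_trans sl.
    by exists x.
  + by move=> y Xy; rewrite T_def.
  + exact: QX.
- exists C => // f; apply: Cr_norm_le; first by rewrite mulr_ge0.
  by move=> s x sl Qx; exact: hC.
Qed.

(** The order l never grows under iteration; only the compact set moves, along the orbit. The
    induction is over all Q, since the outer T replaces Q by its image. *)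
Lemma Cr_norm_iter m l Q : order_le l r -> compact Q -> Q `<=` X ->
  exists2 C, 0 <= C & forall f : F X,
    Cr_norm l Q (fun_of (iter m T f)) <= C * Cr_norm l (iter m psi @` Q) (fun_of f).
Proof.
move=> lr; elim: m Q => [|m ih] Q cQ QX.
  by exists 1 => // f; rewrite mul1r image_id.
have [C C0 hC] := Cr_norm_weighted_composition lr cQ QX.
have [cpQ pQX] := Cr_map_image cQ QX.
have [C' C'0 hC'] := ih _ cpQ pQX.
exists (C * C') => [|f]; first exact: mulr_ge0.
rewrite (_ : iter m.+1 psi @` Q = iter m psi @` (psi @` Q)).
  by apply: le_trans (hC _) _; rewrite -mulrA ler_wpM2l// hC'.
rewrite image_comp; congr image; apply/funext => x /=.
by rewrite -iterS iterSr.
Qed.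

Lemma weighted_composition_continuous : continuous T.
Proof.
move=> f A /(F_top X_open)[n [p [e [hp e0 hA]]]].
have TB g h : T (g - h) = T g - T h.
  by rewrite addrC -scaleN1r weighted_composition_linear scaleN1r addrC.
have A0 : nbhs (0 : F X) [set g | forall i, p i g < e].
  apply/(F_top X_open); exists n, p, e; split=> // g /= h i.
  by have := h i; rewrite subr0.
have [l [Q [e' [lr cQ QX e'0 hQ]]]] := Cr_nbhs0 F_Cr F_top X_open A0.
have [C C0 hC] := Cr_norm_weighted_composition lr cQ QX.
have [cpQ pQX] := Cr_map_image cQ QX.
(* C may be 0, and the radius is about to be divided by it. *)
have C1 : 0 < C + 1 by rewrite ltr_wpDl.
have := Cr_norm_nbhs F_top f X_open lr cpQ pQX (divr_gt0 e'0 C1).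
apply: filterS => g /= hg; apply: hA => i /=; rewrite -TB; apply: hQ.
apply: le_lt_trans (hC _) _; move: hg; rewrite ltr_pdivlMr// mulrC.
apply: le_lt_trans; rewrite ler_wpM2r ?lerDl//.
by apply: (Cr_norm_ge0 X_open) => //; exact: F_Cr.
Qed.

Lemma stable_orbits_topologizable : stable_orbits X psi -> topologizable T.
Proof.
move=> stable; split; [exact: weighted_composition_linear|exact: weighted_composition_continuous|move=> p cp].
have [l [Q [e [lr cQ QX e0 hQ]]]] := continuous_seminorm_small F_Cr F_top X_open cp.
have [L [cL LX hL]] := stable Q cQ QX.
exists (fun f => Cr_norm l L (fun_of f)).
  exact: (Cr_norm_continuous_seminorm F_Cr F_top).
move=> m m0; have [C C0 hC] := Cr_norm_iter m lr cQ QX.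
(* The factor 1/e compares p with the seminorm on Q, and C comes from the iterate; adding 1 ensures
   positivity. *)
exists (e^-1 * C + 1) => [|f].
  by rewrite ltr_wpDl// mulr_ge0// invr_ge0 ltW.
have sQ := Cr_norm_seminorm F_Cr X_open lr cQ QX.
apply: le_trans (seminorm_le cp.1 sQ e0 hQ _) _.
have fl : finite_class l X (fun_of f) by exact: F_Cr.
have L0 : 0 <= Cr_norm l L (fun_of f) by exact: (Cr_norm_ge0 X_open).
rewrite mulrDl mul1r -mulrA (@le_trans _ _ (e^-1 * (C * Cr_norm l L (fun_of f))))//.
  apply: ler_wpM2l; first by rewrite invr_ge0 ltW.
  apply: le_trans (hC f) _.
  rewrite ler_wpM2l//; apply: (Cr_norm_mono X_open) => //; exact: hL.
by rewrite lerDl.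
Qed.

Lemma iter_weighted_compositionE m (f : F X) x : X x ->
  fun_of (iter m T f) x =
  (\prod_(j < m) w (iter j psi x)) * fun_of f (iter m psi x).
Proof.
elim: m x => [|m ih] x Xx; first by rewrite big_ord0 mul1r.
rewrite iterS T_def// ih; last exact: psi_X.
rewrite big_ord_recl mulrA -iterSr; congr (_ * _ * _).
by apply: eq_bigr => j _; rewrite /= -iterSr.
Qed.

End weighted_composition.

(** Each point has a neighbourhood, some X_n, contained in all later members. The filter form of
    compactness, applied to indices tending to infinity, then gives one index for all of Q. *)
Lemma exhaustion_compact (R : realType) d (X : set 'rV[R]_d) Xs Q :
  exhaustion X Xs -> compact Q -> Q `<=` X -> exists n, Q `<=` Xs n.
Proof.
move=> [oXs _ cXs UXs] /compact_near_coveringP cQ QX.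
have mono m n : (m <= n)%N -> Xs m `<=` Xs n.
  move=> /subnK <-; elim: (n - m)%N => [//|p ih] x /ih.
  by move=> /subset_closure/cXs.
have [x Qx|n _ hn] := cQ nat \oo (fun n x => Xs n x) _.
- have [n _ Xnx] : (\bigcup_n Xs n) x by rewrite UXs; exact: QX.
  exists (Xs n, [set p | (n <= p)%N]); first split.
  + by apply: open_nbhs_nbhs; split=> //; exact: (oXs n).1.
  + by exists n.
  + by move=> [y p] /= [Xny np]; exact: mono np _ Xny.
- by exists n; apply: hn => /=.
Qed.

(** * Topologizability implies stable orbits *)

Section topologizable_stable.
Variables (R : realType) (k : scalar_kind) (d : nat) (r : option nat).
Variable F : function_sheaf R k d.
Local Notation K := (scalar_field R k).
Local Notation "r %:K" := (scalar_of_real k r) (at level 2, format "r %:K").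
Implicit Types (x y : 'rV[R]_d) (Q Y : set 'rV[R]_d).
Hypothesis F_Cr : sheaf_of_Cr_functions F r.
Hypothesis F_top : forall Y, open Y -> Cr_topology F r Y.
Variables (X : set 'rV[R]_d) (w : 'rV[R]_d -> K) (psi : 'rV[R]_d -> 'rV[R]_d).
Variable T : F X -> F X.
Hypothesis X_open : open X.
Hypothesis w_Cr : Cr r X w.
Hypothesis psi_Cr : Cr_map r X psi.
Hypothesis psi_X : forall x, X x -> X (psi x).
Hypothesis T_def : is_weighted_composition w psi T.

Lemma weight_iter_continuous j x : X x -> {for x, continuous (w \o iter j psi)}.
Proof.
move=> Xx; have cw : {for iter j psi x, continuous w}.
  by apply: (finite_class_continuous (w_Cr (order_le0 r))); exact: iter_psi_closed.
exact: (continuous_comp (Cr_map_iter_continuous psi_Cr psi_X (m := j) Xx) cw).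
Qed.

(** A finite intersection of open dense sets is dense: the conditions already met persist near y by
    continuity, and density supplies a point there meeting the next one. *)
Lemma weights_neq0 m x (O : set 'rV[R]_d) :
  (forall m : nat, X `<=` closure [set y | X y /\ w (iter m psi y) != 0]) ->
  X x -> nbhs x O ->
  exists y, [/\ X y, O y & forall j, (j < m)%N -> w (iter j psi y) != 0].
Proof.
move=> wX Xx xO.
(* With the interior in place of O, the set is again a neighbourhood of each new point. *)
have [y [Xy Oy hy]] : exists y, [/\ X y, O° y &
    forall j, (j < m)%N -> w (iter j psi y) != 0].
  elim: m => [|m [y [Xy Oy hy]]]; first by exists x; split.
  have near_j j : \forall y' \near y, (j < m)%N -> w (iter j psi y') != 0.
    have [jm|mj] := ltnP j m; last by apply: filterE.
    have := weight_iter_continuous (j := j) Xy.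
    move=> /(@cvgr_neq0 _ _ _ (nbhs y) (nbhs_filter y))/(_ (hy j jm)).
    by apply: filterS => y' h _.
  have near_all : \forall y' \near y, forall j, (j < m)%N -> w (iter j psi y') != 0.
    have : \forall y' \near y, forall j : 'I_m, (j < m)%N -> w (iter j psi y') != 0.
      by apply: (@filter_forall _ _ _ (nbhs y) (nbhs_filter y)) => j; exact: near_j.
    by apply: filterS => y' h j jm; exact: (h (Ordinal jm)).
  have OX : nbhs y O° by apply: open_nbhs_nbhs; split=> //; exact: open_interior.
  have [y' [[Xy' wy'] [Oy' hy']]] := wX m y Xy _ (filterI OX near_all).
  exists y'; split=> // j; rewrite ltnS leq_eqVlt => /predU1P[->//|]; exact: hy'.
by exists y; split=> //; exact: interior_subset.
Qed.

(* Glue [0] on [Y] with a multiple of a section not vanishing at [z]. *)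
Lemma glued_section Y U z (a : K) : open Y -> open U -> Y `&` U = set0 ->
  U `<=` X -> U z -> [set f : F X | fun_of f z = 0] <> setT ->
  exists h : F (Y `|` U), (forall x, Y x -> fun_of h x = 0) /\ fun_of h z = a.
Proof.
move=> oY oU YU UX Uz hz.
have [g gz] : exists g : F X, fun_of g z != 0.
  apply: contrapT => no; apply: hz; apply/seteqP; split=> // f _ /=.
  by apply/eqP; apply: contrapT => fz; apply: no; exists f; apply/negP.
(* A two-member cover in the indexed form that gluing expects; compatibility is immediate because Y
   and U are disjoint. *)
pose V (b : bool) := if b then Y else U.
pose s (b : bool) : F (V b) := match b return F (V b) with
  | true => 0
  | false => restr U ((a / fun_of g z) *: g)
  end.
have oV b : open (V b) by case: b.
have oYU : open (Y `|` U) by exact: openU.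
have [|i j x|h hh] := @sheaf_gluing _ _ _ F bool (Y `|` U) V s oYU oV.
- apply/seteqP; split=> [x [Yx|Ux]|x [[] _ ?]]; [by exists true|by exists false|by left|by right].
- have no : ~ (Y x /\ U x) by move=> [Yx Ux]; have : (Y `&` U) x by []; rewrite YU.
  by case: i; case: j => // Vx Vx'; case: no.
exists h; split=> [x Yx|].
  have := fun_of_restr oYU oY (@subsetUl _ Y U) h Yx.
  by rewrite (hh true) fun_of0.
have <- := fun_of_restr oYU oU (@subsetUr _ Y U) h Uz.
by rewrite (hh false) /s fun_of_restr// fun_ofZ ?divfK//; exact: UX.
Qed.

Lemma topologizable_stable_orbits :
  (exists2 Xs : nat -> set 'rV[R]_d, exhaustion X Xs &
    forall n x W, (X `\` closure (Xs n)) x ->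
      open W -> W `<=` X `\` closure (Xs n) -> W x ->
      exists U, [/\ open U, U `<=` W, U x &
        dense (range (@restr _ _ _ F X (Xs n `|` U)))]) ->
  (forall x, X x -> [set f : F X | fun_of f x = 0] <> setT) ->
  (forall m : nat, X `<=` closure [set y | X y /\ w (iter m psi y) != 0]) ->
  topologizable T -> stable_orbits X psi.
Proof.
move=> [Xs exh dense_restr] nonzero wX [_ _ topT] Q cQ QX.
have [oXs cXs clXs _] := exh.
have clX n : closure (Xs n) `<=` X by move=> x /clXs; apply: (oXs n.+1).2.
have [N QN] := exhaustion_compact exh cQ QX.
pose p (f : F X) := Cr_norm 0 (closure (Xs N)) (fun_of f).
have [q cq hq] : exists2 q : F X -> R, continuous_seminorm q & forall m, (0 < m)%N ->
    exists2 gamma : R, 0 < gamma & forall f : F X, p (iter m T f) <= gamma * q f.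
  apply: topT; apply: (Cr_norm_continuous_seminorm F_Cr F_top) => //.
  exact: order_le0.
have [l [Q1 [e [lr cQ1 Q1X e0 hQ1]]]] := continuous_seminorm_small F_Cr F_top X_open cq.
have [n Q1n] := exhaustion_compact exh cQ1 Q1X.
(* The index n comes from q, which was fixed before m, so one compact set serves all iterates. *)
exists (closure (Xs n)); split=> // m m0 _ [x Qx <-]; apply: contrapT => xn.
have [gamma gamma0 hgamma] := hq m m0; have Xx := QX x Qx.
have oC : open (~` closure (Xs n)) by apply: closed_openC; exact: closed_closure.
(* Membership in X_N lets the seminorm p see the perturbed point y; the other condition keeps its
   m-th image away from where q lives. *)
have nbx : nbhs x (Xs N `&` (iter m psi @^-1` (~` closure (Xs n)))).
  apply: filterI; first by apply: open_nbhs_nbhs; split; [exact: (oXs N).1|exact: QN].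
  apply: (Cr_map_iter_continuous psi_Cr psi_X (m := m) Xx).
  by apply: open_nbhs_nbhs; split.
have [y [Xy [Ny yn] wy]] := weights_neq0 m wX Xx nbx.
pose z := iter m psi y; pose W := modulus (\prod_(j < m) w (iter j psi y)).
have Xz : X z by exact: iter_psi_closed.
have W0 : 0 < W.
  by rewrite modulus_gt0; apply/prodf_neq0 => j _; exact: wy.
have oXC : open (X `\` closure (Xs n)) by apply: openI.
have [U [oU UC Uz dU]] := dense_restr n z _ (conj Xz yn) oXC (@subset_refl _ _) (conj Xz yn).
have UX : U `<=` X by move=> u /UC[].
have disj : Xs n `&` U = set0.
  by apply/seteqP; split=> // u [nu /UC[_]]; apply; exact: subset_closure.
(* The contradiction needs a value at z above gamma / W; the extra 1 pays for the error when h is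
   approximated by a section on X. *)
have [h [h0 hz]] := glued_section (1 + gamma / W)%:K (oXs n).1 oU disj UX Uz (nonzero z Xz).
have oV : open (Xs n `|` U) by apply: openU => //; exact: (oXs n).1.
have VX : Xs n `|` U `<=` X by move=> u [/(oXs n).2|/UX].
have cz : compact [set z] by exact: compact_set1.
have zV : [set z] `<=` Xs n `|` U by move=> _ ->; right.
have Q1V : Q1 `<=` Xs n `|` U by move=> u /Q1n; left.
(* Closeness at z in order 0 keeps f(z) large; closeness on [Q1] in order l makes f small there, as
   h vanishes on X_n. *)
have nbh := @filterI _ (nbhs h) (nbhs_filter h) _ _ (Cr_norm_nbhs F_top h oV (order_le0 r) cz zV ltr01)
  (Cr_norm_nbhs F_top h oV lr cQ1 Q1V e0).
(* Density is stated for nonempty open sets, hence the interior, with h as its witness. *)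
have [u [/interior_subset[g1 g2] [f _ fg]]] :=
  dU _ (ex_intro (interior _) h nbh) (@open_interior _ _).
rewrite -{u}fg in g1 g2.
have fE u : (Xs n `|` U) u -> fun_of f u = fun_of h u + fun_of (restr (Xs n `|` U) f - h) u.
  by move=> Vu; rewrite fun_ofB// fun_of_restr// addrCA subrr addr0.
(* The functions f and f - h agree only on X_n, but it is open and contains [Q1], so their seminorms
   there coincide. *)
have qf : q f < 1.
  apply: hQ1; move: g2 => /=; congr (_ < e).
  apply: (@Cr_norm_eq _ _ _ (Xs n) (oXs n).1) => // u nu.
  by rewrite fE ?h0 ?add0r//; left.
have fz : gamma < W * modulus (fun_of f z).
  have : modulus (fun_of (restr (Xs n `|` U) f - h) z) < 1.
    apply: le_lt_trans g1.
    apply: (modulus_ipartial_le oV cz zV (s := [::])) => //.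
    by apply: F_Cr => //; exact: order_le0.
  have : modulus (fun_of h z) = 1 + gamma / W.
    rewrite hz modulus_real gtr0_norm//.
    by apply: addr_gt0; [exact: ltr01|exact: divr_gt0].
  have : modulus (fun_of h z) <= modulus (fun_of f z)
      + modulus (fun_of (restr (Xs n `|` U) f - h) z).
    rewrite -[X in _ + X]modulusN (le_trans _ (ler_modulusD _ _))//.
    by rewrite fE ?addrK//; right.
  move=> h1 h2 h3; rewrite mulrC -ltr_pdivrMr//.
  by move: (gamma / W) h2 => c h2; lra.
(* The left side is the modulus of T^m f at y, a point of closure X_N. With q(f) < 1 this
   contradicts [fz]. *)
have : W * modulus (fun_of f z) <= gamma * q f.
  apply: le_trans (hgamma f); rewrite -modulusM -(iter_weighted_compositionE psi_X T_def)//.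
  apply: (modulus_ipartial_le X_open (cXs N) (clX N) (s := [::])) => //.
    by apply: F_Cr => //; exact: order_le0.
  exact: subset_closure.
move=> /(lt_le_trans fz); rewrite ltNge => /negP; apply.
by rewrite ler_piMr// ltW.
Qed.

End topologizable_stable.

Unset Implicit Arguments.
Set Strict Implicit.

Theorem corollary3p12 (R : realType) (k : scalar_kind) (d : nat)
    (r : option nat) (F : function_sheaf R k d)
    (X : set 'rV[R]_d) (w : 'rV[R]_d -> scalar_field R k)
    (psi : 'rV[R]_d -> 'rV[R]_d) (T : F X -> F X)
    (r_pos : order_le 1 r)
    (F_Cr : sheaf_of_Cr_functions F r)
    (F_F1 : property_F1 F)
    (F_top : forall Y, open Y -> Cr_topology F r Y)
    (X_open : open X)
    (w_Cr : Cr r X w)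
    (psi_Cr : Cr_map r X psi)
    (psi_X : forall x, X x -> X (psi x))
    (T_def : is_weighted_composition w psi T)
    (cond_a : exists2 Xs : nat -> set 'rV[R]_d, exhaustion X Xs &
      forall n x W, (X `\` closure (Xs n)) x ->
        open W -> W `<=` X `\` closure (Xs n) -> W x ->
        exists U, [/\ open U, U `<=` W, U x &
          dense (range (@restr _ _ _ F X (Xs n `|` U)))])
    (cond_b : forall x, X x -> [set f : F X | fun_of f x = 0] <> setT)
    (cond_c : forall m : nat,
      X `<=` closure [set y | X y /\ w (iter m psi y) != 0]) :
  topologizable T <-> stable_orbits X psi.
Proof.
split.
- exact: (topologizable_stable_orbits F_Cr F_top X_open w_Cr psi_Cr psi_X T_def).
- exact: (stable_orbits_topologizable F_Cr F_top X_open w_Cr psi_Cr psi_X T_def).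
Qed.
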